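(* Let $\alpha\in(1,2]$, $\eta\in(0,1]$, $\lambda\in[0,\tfrac{2}{\eta^2})$, and let $f\in C([0,1]\times[0,\infty),[0,\infty))$. Suppose that either (a) $\displaystyle\lim_{x\to0^+}\min_{t\in[0,1]}\frac{f(t,x)}{x}=\infty$ and $\displaystyle\lim_{x\to+\infty}\max_{t\in[0,1]}\frac{f(t,x)}{x}=0$, or (b) $\displaystyle\lim_{x\to0^+}\max_{t\in[0,1]}\frac{f(t,x)}{x}=0$ and $\displaystyle\lim_{x\to+\infty}\min_{t\in[0,1]}\frac{f(t,x)}{x}=\infty$. Then the boundary value problem $$D^\alpha x(t)+f(t,x(t))=0,\quad t\in[0,1],\qquad x(0)=0,\quad x(1)=\lambda\int_0^\eta x(t)\,dt,$$ has at least one positive solution.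
   Context: Conformable derivative: for $\alpha\in(1,2]$ and a function $x$ that is differentiable at points $t>0$, $D^\alpha x(t)=\lim_{\epsilon\to0}\frac{x'(t+\epsilon t^{2-\alpha})-x'(t)}{\epsilon}$ for $t>0$, provided the limit exists (one-sided at the right endpoint of the interval); equivalently $D^\alpha x(t)=t^{2-\alpha}x''(t)$ for $t>0$. At $t=0$, $D^\alpha x(0)=\lim_{t\to0^+}D^\alpha x(t)$, provided this limit exists. A solution of the boundary value problem is a function $x\in C([0,1],\mathbb R)$, differentiable on $(0,1]$, for which $D^\alpha x$ exists on $[0,1]$, and which satisfies the equation and the boundary conditions. A positive solution is a solution $x$ with $x(t)\ge0$ for all $t\in[0,1]$ and $x\not\equiv0$. *)

(* Defs.v *)
From HB Require Import structures.
From mathcomp Require Import all_boot all_order all_algebra.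
From mathcomp Require Import all_classical all_reals all_analysis.
Set Implicit Arguments.
Unset Strict Implicit.
Unset Printing Implicit Defensive.
Import Order.TTheory GRing.Theory Num.Theory.
Import numFieldNormedType.Exports.

Local Open Scope classical_set_scope.
Local Open Scope ring_scope.

(* Functions on [0,1] are represented by total functions [R -> R]; all the
   notions below only look at their values on [0,1], so that the derivatives
   at the endpoint 1 are one-sided. *)

Definition diff_quot {R : realType} (x : R -> R) (t h : R) : R :=
  (x (t + h) - x t) / h.

(* h -> 0, h != 0, with t + h in [0,1] *)
Definition incr_to0 {R : realType} (t : R) : set_system R :=
  within [set h | t + h \in `[0, 1]] 0^'.

Definition differentiable01 {R : realType} (x : R -> R) (t : R) : Prop :=
  cvg (diff_quot x t h @[h --> incr_to0 t]).

Definition deriv01 {R : realType} (x : R -> R) (t : R) : R :=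
  lim (diff_quot x t h @[h --> incr_to0 t]).

Definition conf_quot {R : realType} (alpha : R) (x : R -> R) (t e : R) : R :=
  (deriv01 x (t + e * t `^ (2 - alpha)) - deriv01 x t) / e.

(* e -> 0, e != 0, with t + e t^(2 - alpha) in (0,1], where x' is defined *)
Definition conf_incr_to0 {R : realType} (alpha t : R) : set_system R :=
  within [set e | t + e * t `^ (2 - alpha) \in `]0, 1]] 0^'.

(* The conformable derivative at t > 0 *)
Definition conf_derivable_pos {R : realType} (alpha : R) (x : R -> R) (t : R)
  : Prop := cvg (conf_quot alpha x t e @[e --> conf_incr_to0 alpha t]).

Definition conf_deriv_pos {R : realType} (alpha : R) (x : R -> R) (t : R) : R :=
  lim (conf_quot alpha x t e @[e --> conf_incr_to0 alpha t]).

Definition conf_derivable {R : realType} (alpha : R) (x : R -> R) (t : R)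
  : Prop :=
  if t == 0 then
    (\forall s \near 0^'+, conf_derivable_pos alpha x s) /\
    cvg (conf_deriv_pos alpha x s @[s --> 0^'+])
  else conf_derivable_pos alpha x t.

Definition conf_deriv {R : realType} (alpha : R) (x : R -> R) (t : R) : R :=
  if t == 0 then lim (conf_deriv_pos alpha x s @[s --> 0^'+])
  else conf_deriv_pos alpha x t.

Definition bvp_solution {R : realType} (alpha eta lambda : R) (f : R -> R -> R)
    (x : R -> R) : Prop :=
  [/\ {within `[0, 1], continuous x},
      forall t, t \in `]0, 1] -> differentiable01 x t,
      forall t, t \in `[0, 1] -> conf_derivable alpha x t,
      forall t, t \in `[0, 1] -> conf_deriv alpha x t + f t (x t) = 0 &
      x 0 = 0 /\
      x 1 = lambda * \int[lebesgue_measure]_(t in `[0, eta]) x t].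

Definition bvp_positive_solution {R : realType} (alpha eta lambda : R)
    (f : R -> R -> R) (x : R -> R) : Prop :=
  [/\ bvp_solution alpha eta lambda f x,
      forall t, t \in `[0, 1] -> 0 <= x t &
      exists2 t, t \in `[0, 1] & x t != 0].

(* Minimum and maximum over [0,1]; they are attained for continuous functions,
   see min01_attained and max01_attained. *)
Definition min01 {R : realType} (g : R -> R) : R := inf (g @` `[0, 1]).

Definition max01 {R : realType} (g : R -> R) : R := sup (g @` `[0, 1]).

Lemma min01_attained (R : realType) (g : R -> R) :
  {within `[0, 1], continuous g} ->
  exists2 c, c \in `[0, 1] &
    min01 g = g c /\ forall t, t \in `[0, 1] -> g c <= g t.
Proof.
move=> cg; have [c c01 gc] := EVT_min ler01 cg.
exists c => //; split=> //; apply/eqP; rewrite eq_le; apply/andP; split.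
  by apply: ge_inf; [exists (g c) => _ [t t01 <-]; exact: gc | exists c].
by apply: lb_le_inf => [|_ [t t01 <-]]; [exists (g c), c | exact: gc].
Qed.

Lemma max01_attained (R : realType) (g : R -> R) :
  {within `[0, 1], continuous g} ->
  exists2 c, c \in `[0, 1] &
    max01 g = g c /\ forall t, t \in `[0, 1] -> g t <= g c.
Proof.
move=> cg; have [c c01 gc] := EVT_max ler01 cg.
exists c => //; split=> //; apply/eqP; rewrite eq_le; apply/andP; split.
  by apply: ge_sup => [|_ [t t01 <-]]; [exists (g c), c | exact: gc].
by apply: ub_le_sup; [exists (g c) => _ [t t01 <-]; exact: gc | exists c].
Qed.

(* Main.v *)
Require Import Defs.
From HB Require Import structures.
From mathcomp Require Import all_boot all_order all_algebra.
From mathcomp Require Import all_classical all_reals all_analysis.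
From mathcomp Require Import ring lra.
Set Implicit Arguments.
Unset Strict Implicit.
Unset Printing Implicit Defensive.
Import Order.TTheory GRing.Theory Num.Theory.
Import numFieldNormedType.Exports.

Local Open Scope classical_set_scope.
Local Open Scope ring_scope.

(** In terms of the primitive [V(t) = t^(alpha - 1) / (alpha - 1)] of the
    singular weight [t^(alpha - 2)], the equation says that the derivative of
    [x'] with respect to [V] is [- f(t, x)], a regular first order system for
    [x] and [x'].  The problem is solved by shooting from [x(0) = 0],
    [x'(0) = s]: with [z] the primitive of [x], one looks for a slope [s > 0]
    at which the defect [x(1) - lambda z(eta)] vanishes.

    Solutions of the initial value problem are concave.  Together with
    [lambda < 2 / eta^2] this shows that a solution whose defect is
    nonnegative is itself nonnegative on the whole interval
    ([trajectory_ge0]), so a zero of the defect yields a positive solution.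

    The growth of [f] gives the defect opposite signs at two slopes.  Where
    [f(t, u) / u] is small, the solution is close to the line [s t], whose
    defect [s (1 - lambda eta^2 / 2)] is positive ([defect_gt0]).  Where
    [f(t, u) / u] is large, a nonnegative solution would be comparable to its
    maximum on the middle half of the interval, and the equation would bend
    it more than concavity and nonnegativity permit
    ([trajectory_not_superlinear]); hence the defect is negative.  Small and
    large slopes fall under these two regimes, in one order or the other
    according to the two sets of hypotheses.

    As [f] is only continuous, initial value problems may have several
    solutions and the defect is not a function of [s].  The intermediate value
    theorem is therefore applied to the explicit Euler approximations, which
    depend continuously on [s].  Bounded Euler approximations are
    equicontinuous, so along an ultrafilter of indices they converge to
    solutions, whatever the choice of their slopes
    ([euler_cvg_trajectory]).  With constant slopes this transfers the two
    signs to the approximations; with slopes at which the approximate defect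
    vanishes it produces the solution ([shooting]). *)

(** * Grid functions and their limits *)

Definition grid {R : realType} (n k : nat) : R := k%:R / n.+1%:R.

Definition grid_index {R : realType} (n : nat) (t : R) : nat :=
  Num.truncn (t * n.+1%:R).

Lemma le_grid (R : realType) (n j k : nat) :
  (j <= k)%N -> grid n j <= grid n k :> R.
Proof. by move=> jk; rewrite ler_pM2r ?invr_gt0 ?ltr0n// ler_nat. Qed.

Lemma grid_in01 (R : realType) (n k : nat) :
  (k <= n.+1)%N -> (grid n k : R) \in `[0, 1].
Proof.
move=> kn; rewrite in_itv/= divr_ge0 ?ler0n//=.
by rewrite ler_pdivrMr ?ltr0n// mul1r ler_nat.
Qed.

Lemma grid_index_le (R : realType) (n : nat) (t : R) :
  t <= 1 -> (grid_index n t <= n.+1)%N.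
Proof.
move=> t1; rewrite truncn_le_nat (le_lt_trans (y := n.+1%:R))//.
  by rewrite ler_piMl ?ler0n.
by rewrite ltr_nat.
Qed.

Lemma grid_index_dist (R : realType) (n : nat) (t : R) :
  0 <= t -> `|grid n (grid_index n t) - t| <= n.+1%:R^-1.
Proof.
move=> t0; have n0 : 0 < n.+1%:R :> R by rewrite ltr0n.
have /truncn_itv/andP[] : 0 <= t * n.+1%:R by rewrite mulr_ge0// ltW.
rewrite -/(grid_index n t) -ler_pdivrMr// -ltr_pdivlMr//.
rewrite -[(_ t).+1%:R]natr1 mulrDl mul1r -/(grid _ _) => lo hi.
have : 0 < n.+1%:R^-1 :> R by rewrite invr_gt0.
move: (grid n _) (_^-1) lo hi => a b lo hi b0.
by rewrite ler_norml; apply/andP; split; lra.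
Qed.

Lemma grid_index_cvg (R : realType) (t : R) :
  0 <= t -> grid n (grid_index n t) @[n --> \oo] --> t.
Proof.
move=> t0; apply/cvgrPdist_le => e e0.
have := @cvg_harmonic R => /cvgrPdist_le /(_ e e0); apply: filterS => n.
rewrite sub0r normrN ger0_norm ?invr_ge0 ?ler0n// distrC.
exact: le_trans (grid_index_dist n t0).
Qed.

Lemma within01_continuousP (R : realType) (P : R -> R) :
  {within `[0, 1], continuous P} <->
  forall t e : R, t \in `[0, 1] -> 0 < e -> exists2 d : R, 0 < d &
    forall b : R, b \in `[0, 1] -> `|b - t| < d -> `|P b - P t| <= e.
Proof.
split=> [/subspace_continuousP cP t e t01 e0|H].
  have /cvgrPdist_le/(_ e e0)[d d0 Pd] := cP t t01.
  exists d => // b b01 bt; rewrite distrC; apply: Pd => //=.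
  by rewrite /ball/= distrC.
apply/subspace_continuousP => t t01; apply/cvgrPdist_le => e e0.
have [d d0 Pd] := H t e t01 e0; exists d => //= b.
by rewrite /ball/= distrC => bt b01; rewrite distrC; apply: Pd.
Qed.

(** Continuous convergence along the refining grids.  The number [d] does not
    depend on [n]: this local uniformity is what allows the passage to the
    limit in sums over all the grid points of a short interval. *)
Definition grid_cvg {R : realType} (U : set_system nat)
    (u : nat -> nat -> R) (v : R -> R) : Prop :=
  forall t e : R, t \in `[0, 1] -> 0 < e -> exists2 d : R, 0 < d &
    \forall n \near U, forall i, (i <= n.+1)%N ->
      `|grid n i - t| < d -> `|u n i - v t| <= e.

Lemma grid_cvg_at (R : realType) (U : set_system nat) (FU : Filter U)
    (u : nat -> nat -> R) (v : R -> R) (k : nat -> nat) (t : R) :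
  grid_cvg U u v -> t \in `[0, 1] -> (forall n, (k n <= n.+1)%N) ->
  grid n (k n) @[n --> U] --> t -> u n (k n) @[n --> U] --> v t.
Proof.
move=> uv t01 kn kt; apply/cvgrPdist_le => e e0.
have [d d0 Hd] := uv t e t01 e0.
move/cvgrPdist_lt : kt => /(_ d d0) kt.
by apply: filterS2 Hd kt => n Hd kt; rewrite distrC Hd// distrC.
Qed.

(** Euler's rule for the integral of [phi] against [dP] on the grid of mesh
    [1 / (n + 1)].  Allowing an integrator [P] other than the identity is what
    absorbs the singular weight of the conformable equation. *)
Definition euler_sum {R : realType} (P : R -> R) (n : nat) (u phi : nat -> R)
  : Prop :=
  forall i, (i <= n)%N ->
    u i.+1 = u i + (P (grid n i.+1) - P (grid n i)) * phi i.

Definition nondecreasing01 {R : realType} (P : R -> R) : Prop :=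
  {in `[0, 1] &, {homo P : a b / a <= b}}.

Lemma euler_sum_increment (R : realType) (P : R -> R) (n : nat)
    (u phi : nat -> R) (c e : R) (j k : nat) :
  nondecreasing01 P -> euler_sum P n u phi -> (j <= k <= n.+1)%N ->
  (forall i, (j <= i < k)%N -> `|phi i - c| <= e) ->
  `|u k - u j - c * (P (grid n k) - P (grid n j))|
    <= e * (P (grid n k) - P (grid n j)).
Proof.
move=> mP ES /andP[]; elim: k => [|k IH].
  by rewrite leqn0 => /eqP -> _ _; rewrite !subrr !mulr0 subr0 normr0.
rewrite leq_eqVlt => /orP[/eqP -> _ _|].
  by rewrite !subrr !mulr0 subr0 normr0.
rewrite ltnS => jk kn Hphi.
have {}IH : `|u k - u j - c * (P (grid n k) - P (grid n j))|
    <= e * (P (grid n k) - P (grid n j)).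
  apply: IH => //; first exact: ltnW.
  by move=> i /andP[ji ik]; apply: Hphi; rewrite ji ltnS ltnW.
have dP : 0 <= P (grid n k.+1) - P (grid n k).
  by rewrite subr_ge0; apply: mP; rewrite ?grid_in01 ?le_grid// ltnW.
rewrite (ES _ kn).
have -> : u k + (P (grid n k.+1) - P (grid n k)) * phi k - u j -
    c * (P (grid n k.+1) - P (grid n j)) =
    (u k - u j - c * (P (grid n k) - P (grid n j))) +
    (P (grid n k.+1) - P (grid n k)) * (phi k - c) by ring.
have -> : e * (P (grid n k.+1) - P (grid n j)) =
   e * (P (grid n k) - P (grid n j)) + (P (grid n k.+1) - P (grid n k)) * e.
  by ring.
apply: le_trans (ler_normD _ _) _; apply: lerD => //.
rewrite normrM (ger0_norm dP) ler_wpM2l//.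
by apply: Hphi; rewrite jk ltnSn.
Qed.

(** Differentiation of [u] with respect to [P], one-sided at the ends of the
    unit interval, in a form that makes sense also where [P] itself is not
    differentiable: the weight of the equation is singular at zero. *)
Definition dderiv {R : realType} (P u phi : R -> R) : Prop :=
  forall t e : R, t \in `[0, 1] -> 0 < e -> exists2 d : R, 0 < d &
    forall b : R, b \in `[0, 1] -> `|b - t| < d ->
      `|u b - u t - phi t * (P b - P t)| <= e * `|P b - P t|.

Lemma euler_sum_increment_norm (R : realType) (P : R -> R) (n : nat)
    (u phi : nat -> R) (c e : R) (j k : nat) :
  nondecreasing01 P -> euler_sum P n u phi -> (j <= n.+1)%N -> (k <= n.+1)%N ->
  (forall i, (minn j k <= i < maxn j k)%N -> `|phi i - c| <= e) ->
  `|u k - u j - c * (P (grid n k) - P (grid n j))|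
    <= e * `|P (grid n k) - P (grid n j)|.
Proof.
move=> mP ES jn kn; have [jk|/ltnW kj] := leqP j k => Hphi.
  have dP : 0 <= P (grid n k) - P (grid n j).
    by rewrite subr_ge0; apply: mP; rewrite ?grid_in01 ?le_grid.
  rewrite (ger0_norm dP); apply: (@euler_sum_increment R P n u phi) => //.
  by rewrite jk.
have dP : 0 <= P (grid n j) - P (grid n k).
  by rewrite subr_ge0; apply: mP; rewrite ?grid_in01 ?le_grid.
rewrite -normrN [X in e * X]distrC (ger0_norm dP).
have -> : - (u k - u j - c * (P (grid n k) - P (grid n j))) =
  u j - u k - c * (P (grid n j) - P (grid n k)) by ring.
by apply: (@euler_sum_increment R P n u phi) => //; rewrite kj.
Qed.

(** The local form of convergence of Riemann-Stieltjes sums: near [t] the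
    integrand is almost constant, so the increments of the sums are almost
    proportional to those of [P], and this survives the limit. *)
Lemma grid_cvg_dderiv (R : realType) (U : set_system nat)
    (FU : ProperFilter U) (Uoo : \oo `<=` U) (P : R -> R)
    (u phi : nat -> nat -> R) (v psi : R -> R) :
  nondecreasing01 P -> {within `[0, 1], continuous P} ->
  (forall n, euler_sum P n (u n) (phi n)) ->
  grid_cvg U u v -> grid_cvg U phi psi -> dderiv P v psi.
Proof.
move=> mP cP ES uv pp t e t01 e0.
have [d d0 Hd] := pp t e t01 e0; exists d => // b b01 bt.
have idx (a : R) : a \in `[0, 1] -> grid n (grid_index n a) @[n --> U] --> a.
  move=> /[!in_itv]/= /andP[a0 _]; apply: cvg_trans (grid_index_cvg a0).
  by apply: cvg_app; exact: Uoo.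
have idxn (a : R) n : a \in `[0, 1] -> (grid_index n a <= n.+1)%N.
  by move=> /[!in_itv]/= /andP[_]; exact: grid_index_le.
have cu (a : R) : a \in `[0, 1] -> u n (grid_index n a) @[n --> U] --> v a.
  by move=> a01; apply: (grid_cvg_at _ uv) => // [n|]; [exact: idxn|exact: idx].
have cPi (a : R) : a \in `[0, 1] ->
    P (grid n (grid_index n a)) @[n --> U] --> P a.
  move=> a01; apply/cvgrPdist_le => e' e'0.
  have [d' d'0 Pd'] := (within01_continuousP P).1 cP a e' a01 e'0.
  have /cvgrPdist_lt/(_ d' d'0) := idx a a01; apply: filterS => n.
  by rewrite distrC (distrC (P a)); apply: Pd'; rewrite grid_in01 ?idxn.
have FU' : Filter U by exact: filter_filter.
pose j n := grid_index n t; pose k n := grid_index n b.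
have c2 : (P (grid n (k n)) - P (grid n (j n))) @[n --> U] --> P b - P t.
  exact: cvgB (cPi _ b01) (cPi _ t01).
have cl : `|u n (k n) - u n (j n) -
    psi t * (P (grid n (k n)) - P (grid n (j n)))| @[n --> U] -->
    `|v b - v t - psi t * (P b - P t)|.
  apply: cvg_norm; apply: cvgB; first exact: cvgB (cu _ b01) (cu _ t01).
  by apply: cvgM c2; exact: cvg_cst.
have cr : e * `|P (grid n (k n)) - P (grid n (j n))| @[n --> U] -->
    e * `|P b - P t|.
  by apply: cvgM; [exact: cvg_cst | exact: cvg_norm].
apply: ler_cvg_to cl cr _.
have /cvgrPdist_lt/(_ d d0) nt := idx t t01.
have db0 : 0 < d - `|b - t| by rewrite subr_gt0.
have /cvgrPdist_lt/(_ _ db0) nb := idx b b01.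
apply: filterS3 nt nb Hd => n nt nb Hd.
apply: euler_sum_increment_norm => //; [exact: idxn|exact: idxn|].
have gt : `|grid n (grid_index n t) - t| < d by rewrite distrC.
have gb : `|grid n (grid_index n b) - t| < d.
  rewrite -(subrKA b); apply: le_lt_trans (ler_normD _ _) _.
  by rewrite -ltrBrDr distrC.
move=> i /andP[lo hi]; apply: Hd.
  rewrite (leq_trans (ltnW hi))// geq_max; apply/andP; split; exact: idxn.
move: gt gb lo hi; rewrite !ltr_norml => /andP[t1 t2] /andP[b1 b2].
have [jk|/ltnW kj] := leqP (grid_index n t) (grid_index n b) => lo /ltnW hi.
  have := le_grid R n lo; have := le_grid R n hi => h1 h2.
  by apply/andP; split; lra.
have := le_grid R n lo; have := le_grid R n hi => h1 h2.
by apply/andP; split; lra.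
Qed.

Lemma ultra_fmap (T S : Type) (f : T -> S) (U : set_system T) :
  UltraFilter U -> UltraFilter (f x @[x --> U]).
Proof.
move=> FU; split=> [|G GF sUG]; first exact: fmap_proper_filter.
rewrite predeqE => A; split=> [GA|]; last exact: sUG.
have [//|UnA] := in_ultra_setVsetC (f @^-1` A) FU.
by have /filter_ex[? []] : G (A `&` ~` A) by apply: filterI => //; exact: sUG.
Qed.

(** Equicontinuity plus compactness of bounded sets of reals: an ultrafilter
    selects all the pointwise limits at once, so no subsequence has to be
    extracted. *)
Lemma euler_sum_grid_cvg (R : realType) (U : set_system nat)
    (FU : UltraFilter U) (Uoo : \oo `<=` U) (P : R -> R)
    (u phi : nat -> nat -> R) (L C : R) :
  nondecreasing01 P -> {within `[0, 1], continuous P} ->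
  (forall n, euler_sum P n (u n) (phi n)) ->
  (forall n i, (i <= n.+1)%N -> `|u n i| <= L) ->
  (forall n i, (i <= n.+1)%N -> `|phi n i| <= C) ->
  exists v, grid_cvg U u v.
Proof.
move=> mP cP ES uL phiC.
have C0 : 0 <= C by apply: le_trans (phiC 0%N 0%N _).
have lims (t : R) : exists l : R, t \in `[0, 1] ->
    u n (grid_index n t) @[n --> U] --> l.
  have [t01|] := boolP (t \in `[0, 1]); last by exists 0.
  have : compact `[- L, L] by exact: segment_compact.
  rewrite compact_ultra => /(_ (u n (grid_index n t) @[n --> U])).
  case=> [||l [_ ul]]; [exact: ultra_fmap| |by exists l].
  have : \forall n \near U, `|u n (grid_index n t)| <= L.
    apply: filterE => n; apply: uL.
    by move: t01; rewrite in_itv/= => /andP[_]; exact: grid_index_le.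
  by apply: filterS => n; rewrite ler_norml /= in_itv.
have [v Hv] := choice lims; exists v => t e t01 e0.
have e1 : 0 < e / 2 / (2 * (C + 1)) by rewrite !divr_gt0// mulr_gt0// ltr_wpDl.
have [d d0 Pd] := (within01_continuousP P).1 cP t _ t01 e1.
exists d => //.
have t0 : 0 <= t by move: t01; rewrite in_itv => /andP[].
have tn n : (grid_index n t <= n.+1)%N.
  by apply: grid_index_le; move: t01; rewrite in_itv => /andP[].
have gt : \forall n \near U, `|grid n (grid_index n t) - t| < d.
  apply: Uoo; have /cvgrPdist_lt/(_ d d0) := grid_index_cvg t0.
  by apply: filterS => n; rewrite distrC.
have e20 : 0 < e / 2 by rewrite divr_gt0.
have /cvgrPdist_le/(_ _ e20) ut := Hv t t01.
apply: filterS2 gt ut => n gt ut i ni it.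
rewrite -(subrKA (u n (grid_index n t))) (le_trans (ler_normD _ _))//.
rewrite [e]splitr lerD//; last by rewrite distrC.
have := @euler_sum_increment_norm R P n (u n) (phi n) 0 C (grid_index n t) i
  mP (ES n) (tn n) ni.
rewrite mul0r subr0 => /(_ _)/le_trans; apply.
  move=> k /andP[_ /ltnW hk]; rewrite subr0 phiC// (leq_trans hk)//.
  by rewrite geq_max ni tn.
have := Pd _ (grid_in01 R ni) it; have := Pd _ (grid_in01 R (tn n)) gt.
set q := _ / (2 * (C + 1)) in e1 *; rewrite !ler_norml => h1 h2.
have -> : e / 2 = (C + 1) * (q + q).
  by rewrite /q; field; rewrite gt_eqF// ltr_wpDl.
apply: ler_pM => //; first by rewrite lerDl.
by rewrite ler_norml; apply/andP; split; lra.
Qed.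
(** * Euler approximations of the initial value problem *)

(** Approximations of [x], of [x'] and of the integral of [x] at the grid
    points.  Carrying the integral as a third unknown turns the nonlocal
    boundary condition into a condition on values of the solution. *)
Fixpoint euler {R : realType} (g : R -> R -> R) (V : R -> R) (n : nat) (s : R)
    (k : nat) : R * R * R :=
  if k is i.+1 then
    let x := (euler g V n s i).1.1 in
    let y := (euler g V n s i).1.2 in
    let z := (euler g V n s i).2 in
    (x + (grid n i.+1 - grid n i) * y,
     y + (V (grid n i.+1) - V (grid n i)) * - g (grid n i) x,
     z + (grid n i.+1 - grid n i) * x)
  else (0, s, 0).

Definition euler_x {R : realType} (g : R -> R -> R) (V : R -> R) (n : nat)
  (s : R) (k : nat) : R := (euler g V n s k).1.1.
Definition euler_y {R : realType} (g : R -> R -> R) (V : R -> R) (n : nat)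
  (s : R) (k : nat) : R := (euler g V n s k).1.2.
Definition euler_z {R : realType} (g : R -> R -> R) (V : R -> R) (n : nat)
  (s : R) (k : nat) : R := (euler g V n s k).2.

Lemma euler_x_sum (R : realType) (g : R -> R -> R) (V : R -> R) (n : nat)
  (s : R) : euler_sum id n (euler_x g V n s) (euler_y g V n s).
Proof. by []. Qed.

Lemma euler_y_sum (R : realType) (g : R -> R -> R) (V : R -> R) (n : nat)
    (s : R) :
  euler_sum V n (euler_y g V n s)
    (fun i => - g (grid n i) (euler_x g V n s i)).
Proof. by []. Qed.

Lemma euler_z_sum (R : realType) (g : R -> R -> R) (V : R -> R) (n : nat)
  (s : R) : euler_sum id n (euler_z g V n s) (euler_x g V n s).
Proof. by []. Qed.

Lemma euler_continuous (R : realType) (g : R -> R -> R) (V : R -> R)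
    (n k : nat) :
  continuous (fun p : R * R => g p.1 p.2) ->
  [/\ continuous (fun s => euler_x g V n s k),
      continuous (fun s => euler_y g V n s k) &
      continuous (fun s => euler_z g V n s k)].
Proof.
move=> cg; elim: k => [|k [cx cy cz]].
  by split=> s; [exact: cvg_cst|exact: cvg_id|exact: cvg_cst].
have step (u v : R -> R) c : continuous u -> continuous v ->
    continuous (fun s => u s + c * v s).
  move=> cu cv s; apply: cvgD; first exact: cu.
  by apply: cvgM; [exact: cvg_cst|exact: cv].
split; [exact: step|apply: step => // s|exact: step].
apply: cvgN; apply: (@continuous2_cvg _ R R R (nbhs s) _ (fun=> grid n k)
  (fun r => euler_x g V n r k) g (grid n k) (euler_x g V n s k)).
- exact: (cg (grid n k, euler_x g V n s k)).
- exact: cvg_cst.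
- exact: cx.
Qed.

Lemma nondecreasing01_id (R : realType) : nondecreasing01 (@id R).
Proof. by []. Qed.

Lemma within01_continuous_id (R : realType) :
  {within `[0, 1], continuous (@id R)}.
Proof. by apply: continuous_subspaceT => x; exact: cvg_id. Qed.

Lemma grid0 (R : realType) (n : nat) : grid n 0 = 0 :> R.
Proof. by rewrite /grid mul0r. Qed.

Lemma gridn (R : realType) (n : nat) : grid n n.+1 = 1 :> R.
Proof. by rewrite /grid divff// pnatr_eq0. Qed.

Lemma euler_sum_norm (R : realType) (P : R -> R) (n : nat) (u phi : nat -> R)
    (C : R) (k : nat) :
  nondecreasing01 P -> euler_sum P n u phi -> (k <= n.+1)%N -> 0 <= C ->
  (forall i, (i < k)%N -> `|phi i| <= C) ->
  `|u k| <= `|u 0%N| + C * (P 1 - P 0).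
Proof.
move=> mP ES kn C0 phiC; rewrite -(subrK (u 0%N) (u k)) addrC.
apply: le_trans (ler_normD _ _) _; rewrite lerD2l.
have := @euler_sum_increment R P n u phi 0 C 0 k mP ES kn.
rewrite mul0r subr0 => /(_ _)/le_trans; apply.
  by move=> i ik; rewrite subr0 phiC.
rewrite grid0 ler_wpM2l// lerD2r; apply: mP; rewrite ?grid_in01//.
  by rewrite in_itv/= ler01 lexx.
by rewrite -(gridn R n) le_grid.
Qed.

(** As [g] is nonnegative the slopes never exceed [s], so the approximations
    stay below [S], where [g] is bounded; the bounds do not depend on [n]. *)
Lemma euler_bounded (R : realType) (g : R -> R -> R) (V : R -> R) (S C : R) :
  nondecreasing01 V ->
  (forall t u : R, t \in `[0, 1] -> u <= S -> 0 <= g t u <= C) ->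
  (forall t u : R, 0 <= g t u) -> 0 <= S ->
  exists L : R, forall (n : nat) (s : R) (i : nat),
    0 <= s <= S -> (i <= n.+1)%N ->
    [/\ `|euler_x g V n s i| <= L, `|euler_y g V n s i| <= L,
        `|euler_z g V n s i| <= L &
        `|- g (grid n i) (euler_x g V n s i)| <= L].
Proof.
move=> mV gC g0 S0.
have C0 : 0 <= C.
  have z01 : (0 : R) \in `[0, 1] by rewrite in_itv/= lexx ler01.
  by have /andP[] := gC 0 0 z01 S0; exact: le_trans.
have V01 : 0 <= V 1 - V 0.
  by rewrite subr_ge0; apply: mV; rewrite ?in_itv/= ?lexx ?ler01.
exists (C + (S + C * (V 1 - V 0))) => n s i /andP[s0 sS] ni.
have CV : 0 <= C * (V 1 - V 0) by exact: mulr_ge0.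
have yS k : (k <= n.+1)%N -> euler_y g V n s k <= S.
  elim: k => [//|k IH kn]; rewrite euler_y_sum//.
  have dV : 0 <= V (grid n k.+1) - V (grid n k).
    by rewrite subr_ge0; apply: mV; rewrite ?grid_in01 ?le_grid// ltnW.
  have := IH (ltnW kn); have := mulr_ge0 dV (g0 (grid n k) (euler_x g V n s k)).
  by rewrite mulrN; lra.
have xS k : (k <= n.+1)%N -> euler_x g V n s k <= S * grid n k.
  elim: k => [|k IH kn]; first by rewrite grid0 mulr0.
  rewrite euler_x_sum//.
  have dg : 0 <= grid n k.+1 - grid n k :> R by rewrite subr_ge0 le_grid.
  have := IH (ltnW kn); have := ler_wpM2l dg (yS k (ltnW kn)).
  move: (grid n k.+1) (grid n k) => b a; lra.
have gb k : (k <= n.+1)%N -> `|- g (grid n k) (euler_x g V n s k)| <= C.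
  move=> kn; rewrite normrN ger0_norm//.
  suff /gC : euler_x g V n s k <= S by move=> /(_ _ (grid_in01 R kn))/andP[].
  apply: le_trans (xS k kn) _; rewrite ler_piMr//.
  by have := grid_in01 R kn; rewrite in_itv => /andP[].
have yb k : (k <= n.+1)%N -> `|euler_y g V n s k| <= S + C * (V 1 - V 0).
  move=> kn.
  apply: le_trans (euler_sum_norm mV (@euler_y_sum R g V n s) kn C0 _) _.
    by move=> j jk; rewrite gb// (leq_trans (ltnW jk)).
  by rewrite lerD2r ger0_norm.
have L0 : 0 <= S + C * (V 1 - V 0) by rewrite addr_ge0.
have xb k : (k <= n.+1)%N -> `|euler_x g V n s k| <= S + C * (V 1 - V 0).
  move=> kn; apply: le_trans (euler_sum_norm (@nondecreasing01_id R)
    (@euler_x_sum R g V n s) kn L0 _) _.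
    by move=> j jk; rewrite yb// (leq_trans (ltnW jk)).
  by rewrite normr0 add0r subr0 mulr1.
have zb k : (k <= n.+1)%N -> `|euler_z g V n s k| <= S + C * (V 1 - V 0).
  move=> kn; apply: le_trans (euler_sum_norm (@nondecreasing01_id R)
    (@euler_z_sum R g V n s) kn L0 _) _.
    by move=> j jk; rewrite xb// (leq_trans (ltnW jk)).
  by rewrite normr0 add0r subr0 mulr1.
split; [have := xb i ni|have := yb i ni|have := zb i ni|have := gb i ni]; lra.
Qed.

Lemma grid_cvg_comp (R : realType) (U : set_system nat) (FU : Filter U)
    (g : R -> R -> R) (u : nat -> nat -> R) (v : R -> R) :
  continuous (fun p : R * R => g p.1 p.2) -> grid_cvg U u v ->
  grid_cvg U (fun n i => - g (grid n i) (u n i)) (fun t => - g t (v t)).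
Proof.
move=> cg uv t e t01 e0.
have /cvgrPdist_le/(_ e e0)/nbhs_ballP[d d0 Hd] := cg (t, v t).
have d20 : 0 < d / 2 by rewrite divr_gt0.
have [d1 d10 Hu] := uv t _ t01 d20.
exists (Num.min d d1); first by rewrite lt_min d0.
apply: filterS Hu => n Hu i ni; rewrite lt_min => /andP[it it1].
rewrite opprK addrC.
apply: (Hd (grid n i, u n i)); split => /=; rewrite /ball/= distrC//.
by apply: le_lt_trans (Hu i ni it1) _; rewrite ltr_pdivrMr// ltr_pMr// ltr1n.
Qed.

(** The initial value problem [x' = y], [y' = - V' g(t, x)], [x(0) = 0],
    [y(0) = s], together with the primitive [z] of [x]. *)
Definition trajectory {R : realType} (g : R -> R -> R) (V : R -> R) (s : R)
    (x y z : R -> R) : Prop :=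
  [/\ x 0 = 0 /\ z 0 = 0, y 0 = s, dderiv id x y, dderiv id z x &
      dderiv V y (fun t => - g t (x t))].

(** Peano's theorem with compactness in the initial slope: uniqueness may
    fail, so continuous dependence on [s] holds only for the approximations,
    and what survives is that limits of approximations are trajectories. *)
Lemma euler_cvg_trajectory (R : realType) (U : set_system nat)
    (FU : UltraFilter U) (Uoo : \oo `<=` U) (g : R -> R -> R) (V : R -> R)
    (S C : R) (s : nat -> R) :
  continuous (fun p : R * R => g p.1 p.2) -> (forall t u : R, 0 <= g t u) ->
  (forall t u : R, t \in `[0, 1] -> u <= S -> 0 <= g t u <= C) ->
  nondecreasing01 V -> {within `[0, 1], continuous V} ->
  0 <= S -> (forall n, 0 <= s n <= S) ->
  exists x y z : R -> R,
    [/\ trajectory g V (y 0) x y z, s n @[n --> U] --> y 0,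
        grid_cvg U (fun n => euler_x g V n (s n)) x &
        grid_cvg U (fun n => euler_z g V n (s n)) z].
Proof.
move=> cg g0 gC mV cV S0 sS.
have [L HL] := euler_bounded mV gC g0 S0.
have mid := @nondecreasing01_id R; have cid := @within01_continuous_id R.
have b1 n i : (i <= n.+1)%N -> `|euler_x g V n (s n) i| <= L.
  by move=> ni; case: (HL n (s n) i (sS n) ni).
have b2 n i : (i <= n.+1)%N -> `|euler_y g V n (s n) i| <= L.
  by move=> ni; case: (HL n (s n) i (sS n) ni).
have b3 n i : (i <= n.+1)%N -> `|euler_z g V n (s n) i| <= L.
  by move=> ni; case: (HL n (s n) i (sS n) ni).
have b4 n i : (i <= n.+1)%N -> `|- g (grid n i) (euler_x g V n (s n) i)| <= L.
  by move=> ni; case: (HL n (s n) i (sS n) ni).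
have esx n := @euler_x_sum R g V n (s n).
have esy n := @euler_y_sum R g V n (s n).
have esz n := @euler_z_sum R g V n (s n).
have [x Hx] := euler_sum_grid_cvg FU Uoo mid cid esx b1 b2.
have [y Hy] := euler_sum_grid_cvg FU Uoo mV cV esy b2 b4.
have [z Hz] := euler_sum_grid_cvg FU Uoo mid cid esz b3 b1.
have PU : ProperFilter U by exact: ultra_proper.
have Hg := grid_cvg_comp (@filter_filter _ U PU) cg Hx.
have at0 (u : nat -> nat -> R) (v : R -> R) :
    grid_cvg U u v -> u n 0%N @[n --> U] --> v 0.
  move=> uv; apply: (grid_cvg_at _ uv) => //.
    by rewrite in_itv/= lexx ler01.
  by apply: cvg_near_cst; apply: filterE => n; rewrite grid0.
exists x, y, z; split=> //; last exact: at0 Hy.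
split=> //.
- have cst0 (l : R) : (0 : R) @[n --> U] --> l -> l = 0.
    by move=> cl; rewrite -(cvg_lim (@Rhausdorff R) cl) lim_cst.
  by split; apply: cst0; [exact: at0 Hx|exact: at0 Hz].
- exact (grid_cvg_dderiv PU Uoo mid cid esx Hx Hy).
- exact (grid_cvg_dderiv PU Uoo mid cid esz Hz Hx).
- exact (grid_cvg_dderiv PU Uoo mV cV esy Hy Hg).
Qed.
(** * Calculus of derivatives with respect to an integrator *)

(** The chain rule for difference quotients along an arbitrary filter.  It
    serves ordinary derivatives, one-sided derivatives and the quotients of
    the conformable derivative alike. *)
Lemma dderiv_quotient_cvg (R : realType) (F : set_system R) (FF : Filter F)
    (P u phi : R -> R) (t c : R) (b q : R -> R) :
  dderiv P u phi -> t \in `[0, 1] ->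
  (\forall h \near F, b h \in `[0, 1]) -> b h @[h --> F] --> t ->
  (P (b h) - P t) / q h @[h --> F] --> c ->
  (u (b h) - u t) / q h @[h --> F] --> phi t * c.
Proof.
move=> du t01 b01 bt Pc.
have c1 : 0 < `|c| + 1 by rewrite ltr_wpDl.
have small : (u (b h) - u t) / q h - phi t * ((P (b h) - P t) / q h)
    @[h --> F] --> 0.
  apply/cvgrPdist_le => e e0.
  have e1 : 0 < e / (`|c| + 1) by rewrite divr_gt0.
  have [d d0 Hd] := du t _ t01 e1.
  have /cvgrPdist_lt/(_ d d0) bt' := bt.
  have /cvgrPdist_lt/(_ 1 ltr01) Pc' := Pc.
  apply: filterS3 b01 bt' Pc' => h b01 bt' Pc'.
  rewrite sub0r normrN mulrA -mulrBl normrM.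
  have := Hd _ b01; rewrite distrC => /(_ bt') Hu.
  apply: le_trans (ler_wpM2r (normr_ge0 _) Hu) _.
  rewrite -mulrA -normrM -[leRHS](divfK (lt0r_neq0 c1)) ler_wpM2l ?ltW//.
  rewrite -[X in `|X|](subrK c); apply: le_lt_trans (ler_normD _ _) _.
  by rewrite addrC ltrD2l distrC.
rewrite -[phi t * c]add0r.
have -> : (fun h => (u (b h) - u t) / q h) = fun h =>
    (u (b h) - u t) / q h - phi t * ((P (b h) - P t) / q h) +
    phi t * ((P (b h) - P t) / q h).
  by apply/funext => h; rewrite subrK.
by apply: cvgD small _; apply: cvgM Pc; exact: cvg_cst.
Qed.

Lemma dderiv_continuous (R : realType) (P u phi : R -> R) :
  {within `[0, 1], continuous P} -> dderiv P u phi ->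
  {within `[0, 1], continuous u}.
Proof.
move=> cP du; apply/within01_continuousP => t e t01 e0.
have c1 : 0 < `|phi t| + 1 by rewrite ltr_wpDl.
have e1 : 0 < e / (`|phi t| + 1) by rewrite divr_gt0.
have [d d0 Hd] := du t 1 t01 ltr01.
have [d' d'0 Hd'] := (within01_continuousP P).1 cP t _ t01 e1.
exists (Num.min d d'); first by rewrite lt_min d0.
move=> b b01; rewrite lt_min => /andP[bd bd'].
have := Hd b b01 bd; have := Hd' b b01 bd' => h1 h2.
rewrite -(subrK (phi t * (P b - P t)) (u b - u t)).
apply: le_trans (ler_normD _ _) _.
rewrite normrM -[leRHS](divfK (lt0r_neq0 c1)) [leRHS]mulrC mulrDl mul1r addrC.
apply: lerD; first by rewrite ler_wpM2l.
by apply: le_trans h2 _; rewrite mul1r.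
Qed.

Lemma quotient_shiftE (R : realType) (w : R -> R) (t : R) :
  (fun h : R => h^-1 *: ((w \o shift t) (h *: 1) - w t)) =
  (fun h : R => (w (h + t) - w t) / h).
Proof. by apply/funext => h /=; rewrite /GRing.scale/= mulr1 mulrC. Qed.

Lemma is_derive_quotient_cvg (R : realType) (w : R -> R) (t d : R) :
  is_derive t 1 w d -> (w (h + t) - w t) / h @[h --> 0^'] --> d.
Proof. by move=> [dw <-]; rewrite -quotient_shiftE; exact: dw. Qed.

Lemma dderiv_is_derive (R : realType) (P u phi : R -> R) (t p : R) :
  t \in `]0, 1[ -> is_derive t 1 P p -> dderiv P u phi ->
  is_derive t 1 u (phi t * p).
Proof.
move=> t01 dP du.
have t01' : t \in `[0, 1] by apply: subset_itvW t01.
have ht : h + t @[h --> 0^'] --> t.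
  rewrite -[X in _ --> X]add0r; apply: cvgD; last exact: cvg_cst.
  exact: nbhs_dnbhs.
have h01 : \forall h \near 0^', h + t \in `[0, 1].
  have H : \forall h \near 0^', h + t \in `]0, 1[.
    exact: ht _ (near_in_itvoo t01).
  by apply: filterS H => h; exact: subset_itvW.
have cu : h^-1 *: ((u \o shift t) (h *: 1) - u t) @[h --> 0^'] -->
    phi t * p.
  rewrite quotient_shiftE; apply: (dderiv_quotient_cvg _ du) => //.
  exact: is_derive_quotient_cvg.
apply: DeriveDef; last exact: cvg_lim.
by apply/cvg_ex; exists (phi t * p).
Qed.

(** Mean value theorem: derivatives with respect to a common nondecreasing
    integrator compare increments. *)
Lemma dderiv_le (R : realType) (P p u v phi psi : R -> R) (a b : R) :
  {within `[0, 1], continuous P} ->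
  (forall t : R, t \in `]0, 1[ -> is_derive t 1 P (p t) /\ 0 <= p t) ->
  dderiv P u phi -> dderiv P v psi -> 0 <= a -> a <= b -> b <= 1 ->
  (forall t : R, t \in `]a, b[ -> phi t <= psi t) ->
  u b - u a <= v b - v a.
Proof.
move=> cP dP du dv a0 ab b1 le.
have sub : {subset `]a, b[ <= `]0, 1[} by apply: subset_itv; rewrite bnd_simp.
have dw t : t \in `]a, b[ -> is_derive t 1 (v - u) (psi t * p t - phi t * p t).
  move=> /sub t01; have [dPt _] := dP t t01.
  apply: is_deriveB; exact: dderiv_is_derive dPt _.
suff H : (v - u) a <= (v - u) b.
  by have : v a - u a <= v b - u b := H; lra.
apply: (@ger0_derive1_ndecr _ _ a b) => //.
- by move=> t /dw[].
- move=> t tab; rewrite derive1E; have [_ ->] := dw t tab.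
  by rewrite -mulrBl mulr_ge0 ?subr_ge0 ?le//; have [] := dP t (sub _ tab).
- have sub' : `[a, b] `<=` `[0, 1] by apply: subset_itv; rewrite bnd_simp.
  apply: continuous_subspaceW sub' _ => t.
  apply: cvgB; first exact: (dderiv_continuous cP dv).
  exact: (dderiv_continuous cP du).
Qed.
(** * Concavity and the sign of the boundary defect *)

(** The growth of [V] over the middle half of the interval is what lets a large
    nonlinearity bend trajectories there. *)
Definition integrator {R : realType} (V p : R -> R) : Prop :=
  [/\ nondecreasing01 V, {within `[0, 1], continuous V}, V (1 / 4) < V (3 / 4) &
      forall t : R, t \in `]0, 1[ -> is_derive t 1 V (p t) /\ 0 <= p t].

Lemma dderiv_linear (R : realType) (P : R -> R) (c : R) :
  dderiv P (fun t => c * P t) (fun=> c).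
Proof.
move=> t e t01 e0; exists 1 => // b b01 bt.
by rewrite -mulrBr subrr normr0 mulr_ge0// ltW.
Qed.

Lemma dderiv_half_square (R : realType) (k : R) :
  dderiv id (fun t => k * (t ^+ 2 / 2)) (fun t => k * t).
Proof.
move=> t e t01 e0; have k1 : 0 < `|k| + 1 by rewrite ltr_wpDl.
exists (e / (`|k| + 1)); first exact: divr_gt0.
move=> b b01; rewrite ltr_pdivlMr// => bt.
have -> : k * (b ^+ 2 / 2) - k * (t ^+ 2 / 2) - k * t * (id b - id t) =
  (k / 2 * (b - t)) * (b - t) by rewrite /=; field.
rewrite normrM ler_wpM2r// !normrM (ger0_norm (x := 2^-1))//.
by have := normr_ge0 k; have := normr_ge0 (b - t); nra.
Qed.

Lemma integrator_id_derive (R : realType) (t : R) :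
  t \in `]0, 1[ -> is_derive t 1 (@id R) ((fun=> 1) t) /\ 0 <= (1 : R).
Proof. by split=> //; exact: is_derive_id. Qed.

Lemma dderiv_id_le (R : realType) (u v phi psi : R -> R) (a b : R) :
  dderiv id u phi -> dderiv id v psi -> 0 <= a -> a <= b -> b <= 1 ->
  (forall t : R, t \in `]a, b[ -> phi t <= psi t) ->
  u b - u a <= v b - v a.
Proof.
exact (dderiv_le (@within01_continuous_id R) (@integrator_id_derive R)).
Qed.

Lemma trajectory_slope_drop (R : realType) (g : R -> R -> R) (V p : R -> R)
    (s : R) (x y z : R -> R) (a b m : R) :
  integrator V p -> trajectory g V s x y z -> 0 <= a -> a <= b -> b <= 1 ->
  (forall t : R, t \in `]a, b[ -> m <= g t (x t)) ->
  m * (V b - V a) <= y a - y b.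
Proof.
move=> [_ cV _ dV] [_ _ _ _ dy] a0 ab b1 mg.
have : y b - y a <= - m * V b - - m * V a.
  apply: (dderiv_le cV dV dy (dderiv_linear V (- m)) a0 ab b1) => t tab.
  by rewrite lerN2 mg.
lra.
Qed.

Lemma trajectory_slope_drop_le (R : realType) (g : R -> R -> R) (V p : R -> R)
    (s : R) (x y z : R -> R) (a b m : R) :
  integrator V p -> trajectory g V s x y z -> 0 <= a -> a <= b -> b <= 1 ->
  (forall t : R, t \in `]a, b[ -> g t (x t) <= m) ->
  y a - y b <= m * (V b - V a).
Proof.
move=> [_ cV _ dV] [_ _ _ _ dy] a0 ab b1 mg.
have : - m * V b - - m * V a <= y b - y a.
  apply: (dderiv_le cV dV (dderiv_linear V (- m)) dy a0 ab b1) => t tab.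
  by rewrite lerN2 mg.
lra.
Qed.

Lemma trajectory_slope_le (R : realType) (g : R -> R -> R) (V p : R -> R)
    (s : R) (x y z : R -> R) (a b : R) :
  (forall t u : R, 0 <= g t u) ->
  integrator V p -> trajectory g V s x y z -> 0 <= a -> a <= b -> b <= 1 ->
  y b <= y a.
Proof.
move=> g0 iV tr a0 ab b1.
have := trajectory_slope_drop (m := 0) iV tr a0 ab b1 (fun _ _ => g0 _ _).
by rewrite mul0r subr_ge0.
Qed.

(** The slope [y] is nonincreasing, so its mean over the interval lies between
    its values at the ends; this is the form in which concavity is used. *)
Lemma trajectory_chord (R : realType) (g : R -> R -> R) (V p : R -> R)
    (s : R) (x y z : R -> R) (a b : R) :
  (forall t u : R, 0 <= g t u) ->
  integrator V p -> trajectory g V s x y z -> 0 <= a -> a <= b -> b <= 1 ->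
  y b * (b - a) <= x b - x a <= y a * (b - a).
Proof.
move=> g0 iV tr a0 ab b1; have [_ _ dx _ _] := tr.
have := dderiv_id_le (dderiv_linear id (y b)) dx a0 ab b1.
have := dderiv_id_le dx (dderiv_linear id (y a)) a0 ab b1.
rewrite /= -!mulrBr => h1 h2; apply/andP; split.
  apply: h2 => t; rewrite in_itv/= => /andP[at_ tb].
  by apply: (trajectory_slope_le g0 iV tr); lra.
apply: h1 => t; rewrite in_itv/= => /andP[at_ tb].
by apply: (trajectory_slope_le g0 iV tr); lra.
Qed.

Lemma trajectory_ratio (R : realType) (g : R -> R -> R) (V p : R -> R)
    (s : R) (x y z : R -> R) (t b : R) :
  (forall t u : R, 0 <= g t u) ->
  integrator V p -> trajectory g V s x y z -> 0 <= t -> t <= b -> b <= 1 ->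
  t * x b <= b * x t.
Proof.
move=> g0 iV tr t0 tb b1; have [[x0 _] _ _ _ _] := tr.
have /andP[h1 _] := trajectory_chord g0 iV tr (lexx 0) t0 (le_trans tb b1).
have /andP[_ h2] := trajectory_chord g0 iV tr t0 tb b1.
rewrite x0 !subr0 in h1.
have h3 := ler_wpM2l t0 h2.
have bt : 0 <= b - t by rewrite subr_ge0.
have h4 := ler_wpM2l bt h1.
by nra.
Qed.

Lemma trajectory_end_ratio (R : realType) (g : R -> R -> R) (V p : R -> R)
    (s : R) (x y z : R -> R) (c t : R) :
  (forall t u : R, 0 <= g t u) ->
  integrator V p -> trajectory g V s x y z -> 0 <= x 1 ->
  0 <= c -> c <= t -> t <= 1 -> (1 - t) * x c <= (1 - c) * x t.
Proof.
move=> g0 iV tr x1 c0 ct t1; have [[x0 _] _ _ _ _] := tr.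
have /andP[h1 _] := trajectory_chord g0 iV tr c0 ct t1.
have /andP[_ h2] := trajectory_chord g0 iV tr (le_trans c0 ct) t1 (lexx 1).
have tc0 : 0 <= t - c by rewrite subr_ge0.
have t10 : 0 <= 1 - t by rewrite subr_ge0.
have h3 := ler_wpM2l t10 h1.
have h4 := ler_wpM2l tc0 h2.
have h5 := mulr_ge0 tc0 x1.
by nra.
Qed.

Lemma trajectory_le (R : realType) (g : R -> R -> R) (V p : R -> R)
    (s : R) (x y z : R -> R) (t : R) :
  (forall t u : R, 0 <= g t u) ->
  integrator V p -> trajectory g V s x y z -> 0 <= t -> t <= 1 -> x t <= s * t.
Proof.
move=> g0 iV tr t0 t1; have [[x0 _] y0 _ _ _] := tr.
have /andP[_] := trajectory_chord g0 iV tr (lexx 0) t0 t1.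
by rewrite x0 y0 !subr0.
Qed.

(** The restriction on [lambda] enters here: a concave [x] with [x(0) = 0]
    satisfies [z(eta) >= eta x(eta) / 2 >= eta^2 x(1) / 2], so the boundary
    inequality forces [x(1)], and then all of [x], to be nonnegative. *)
Lemma trajectory_ge0 (R : realType) (g : R -> R -> R) (V p : R -> R)
    (s eta lambda : R) (x y z : R -> R) :
  (forall t u : R, 0 <= g t u) ->
  integrator V p -> trajectory g V s x y z ->
  0 < eta <= 1 -> 0 <= lambda -> lambda * (eta ^+ 2 / 2) < 1 ->
  lambda * z eta <= x 1 ->
  forall t : R, t \in `[0, 1] -> 0 <= x t.
Proof.
move=> g0 iV tr /andP[eta0 eta1] l0 l1 bc.
have [[_ z0] _ _ dz _] := tr.
have xe : eta * x 1 <= x eta.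
  by have := trajectory_ratio g0 iV tr (ltW eta0) eta1 (lexx 1); rewrite mul1r.
have ze : x eta * (eta / 2) <= z eta.
  have := dderiv_id_le (dderiv_half_square (x eta / eta)) dz (lexx 0) (ltW eta0)
    eta1.
  rewrite z0 /= subr0 expr0n/= mul0r mulr0 subr0.
  have -> : x eta / eta * (eta ^+ 2 / 2) = x eta * (eta / 2).
    by field; rewrite gt_eqF.
  apply => t; rewrite in_itv/= => /andP[t0 te].
  rewrite mulrAC ler_pdivrMr// [leRHS]mulrC [leLHS]mulrC.
  exact: trajectory_ratio g0 iV tr (ltW t0) (ltW te) eta1.
have x1 : 0 <= x 1.
  rewrite leNgt; apply/negP => x1.
  have e2 : 0 <= eta / 2 by lra.
  have h1 := ler_wpM2r e2 xe.
  have h2 := ler_wpM2l l0 (le_trans h1 ze).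
  have h3 : lambda * (eta ^+ 2 / 2) * x 1 <= x 1.
    apply: le_trans bc; apply: le_trans h2.
    by rewrite le_eqVlt; apply/orP; left; apply/eqP; field.
  have : 1 * x 1 < lambda * (eta ^+ 2 / 2) * x 1 by rewrite ltr_nM2r.
  by rewrite mul1r ltNge h3.
move=> t; rewrite in_itv/= => /andP[t0 t1].
have := trajectory_ratio g0 iV tr t0 t1 (lexx 1); rewrite mul1r.
by apply: le_trans; exact: mulr_ge0.
Qed.

(** Harnack's inequality for nonnegative concave functions: [t] is at distance
    at least [1/4] from both endpoints, where [x] is nonnegative, and the graph
    lies above the chords from those endpoints to the point at [c]. *)
Lemma trajectory_harnack (R : realType) (g : R -> R -> R) (V p : R -> R)
    (s : R) (x y z : R -> R) (c t : R) :
  (forall t u : R, 0 <= g t u) ->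
  integrator V p -> trajectory g V s x y z ->
  (forall t : R, t \in `[0, 1] -> 0 <= x t) ->
  c \in `[0, 1] -> t \in `[1 / 4, 3 / 4] -> x c <= 4 * x t.
Proof.
move=> g0 iV tr xge; rewrite !in_itv/= => /andP[c0 c1] /andP[t0 t1].
have t00 : 0 <= t by lra.
have t11 : t <= 1 by lra.
have x1 : 0 <= x 1 by apply: xge; rewrite in_itv/= ler01 lexx.
have xc : 0 <= x c by apply: xge; rewrite in_itv/= c0.
have xt : 0 <= x t by apply: xge; rewrite in_itv/= t00.
have [ct|/ltW tc] := leP c t.
  have := trajectory_end_ratio g0 iV tr x1 c0 ct t11.
  by nra.
have := trajectory_ratio g0 iV tr t00 tc c1.
by nra.
Qed.

Lemma trajectory_mid_gt0 (R : realType) (g : R -> R -> R) (V p : R -> R)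
    (s : R) (x y z : R -> R) (t : R) :
  (forall t u : R, 0 <= g t u) ->
  integrator V p -> trajectory g V s x y z -> 0 < s ->
  (forall t : R, t \in `[0, 1] -> 0 <= x t) ->
  t \in `[1 / 4, 3 / 4] -> 0 < x t.
Proof.
move=> g0 iV tr s0 xge tm; have [[x0 _] y0 dx _ _] := tr.
have z01 : (0 : R) \in `[0, 1] by rewrite in_itv/= lexx ler01.
have s20 : 0 < s / 2 by lra.
have [d d0 Hd] := dx 0 _ z01 s20.
pose b := Num.min (d / 2) 1.
have b0 : 0 < b by rewrite lt_min ltr01 divr_gt0.
have b1 : b <= 1 by rewrite ge_min lexx orbT.
have bd : b < d by rewrite gt_min ltr_pdivrMr// ltr_pMr// ltr1n.
have b01 : b \in `[0, 1] by rewrite in_itv/= (ltW b0).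
have := Hd b b01; rewrite !subr0 /= x0 y0 subr0 (gtr0_norm b0) => /(_ bd).
rewrite ler_norml => /andP[h _].
have := trajectory_harnack g0 iV tr xge b01 tm.
by have := mulr_gt0 s0 b0; lra.
Qed.

(** On the middle half of the interval [x] is comparable to its maximum, and
    concavity bounds the total change of slope there by a multiple of that
    maximum; a nonlinearity dominating [M x] with [M] large would bend [x]
    more than that. *)
Lemma trajectory_not_superlinear (R : realType) (g : R -> R -> R) (V p : R -> R)
    (s M : R) (x y z : R -> R) :
  (forall t u : R, 0 <= g t u) ->
  integrator V p -> trajectory g V s x y z -> 0 < s ->
  (forall t : R, t \in `[0, 1] -> 0 <= x t) -> 0 <= M ->
  80 < M * (V (3 / 4) - V (1 / 4)) ->
  ~ (forall t : R, t \in `[1 / 4, 3 / 4] -> M * x t <= g t (x t)).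
Proof.
move=> g0 iV tr s0 xge M0 Mbig Mx; have [[x0 _] y0 dx _ _] := tr.
have q1 : 1 / 4 \in `[1 / 4, 3 / 4 : R] by rewrite in_itv/=; lra.
have q3 : 3 / 4 \in `[1 / 4, 3 / 4 : R] by rewrite in_itv/=; lra.
have q01 : 1 / 4 \in `[0, 1 : R] by rewrite in_itv/=; lra.
have q31 : 3 / 4 \in `[0, 1 : R] by rewrite in_itv/=; lra.
(* the slope changes by at most [4 (x(1/4) + x(3/4)) <= 20 x(1/4)], against
   at least [M x(1/4) / 4] times the increase of [V] *)
have X0 := trajectory_mid_gt0 g0 iV tr s0 xge q1.
have drop : M * (x (1 / 4) / 4) * (V (3 / 4) - V (1 / 4))
    <= y (1 / 4) - y (3 / 4).
  apply: (trajectory_slope_drop iV tr); [lra|lra|lra|].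
  move=> t tm; have tm' : t \in `[1 / 4, 3 / 4] by apply: subset_itvW tm.
  apply: le_trans (Mx t tm'); rewrite ler_wpM2l// ler_pdivrMr// [leRHS]mulrC.
  exact: trajectory_harnack g0 iV tr xge q01 tm'.
have h0 : (0 : R) <= 1 / 4 by lra.
have h1 : (1 / 4 : R) <= 1 by lra.
have h2 : (0 : R) <= 3 / 4 by lra.
have h3 : (3 / 4 : R) <= 1 by lra.
have /andP[yl _] := trajectory_chord g0 iV tr (lexx 0) h0 h1.
have /andP[_ yr] := trajectory_chord g0 iV tr h2 h3 (lexx 1).
have x1 : 0 <= x 1 by apply: xge; rewrite in_itv/= ler01 lexx.
have hk := trajectory_harnack g0 iV tr xge q31 q1.
rewrite x0 in yl.
move: (x (1 / 4)) (x (3 / 4)) (y (1 / 4)) (y (3 / 4)) X0 drop yl yr hk.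
move=> X X' Y Y' X0 drop yl yr hk.
have h : 80 * (X / 4) < M * (V (3 / 4) - V (1 / 4)) * (X / 4).
  by rewrite ltr_pM2r// divr_gt0.
have : M * (V (3 / 4) - V (1 / 4)) * (X / 4) <= 20 * X.
  by rewrite mulrAC; lra.
by lra.
Qed.

(** When [g] is small along the way, [x(1)] stays close to [s], whereas
    concavity bounds [z(eta)] by the area [s eta^2 / 2] under the tangent. *)
Lemma defect_gt0 (R : realType) (g : R -> R -> R) (V p : R -> R)
    (s c eta lambda : R) (x y z : R -> R) :
  (forall t u : R, 0 <= g t u) ->
  integrator V p -> trajectory g V s x y z ->
  0 <= s -> 0 < eta <= 1 -> 0 <= lambda ->
  (forall t u : R, t \in `[0, 1] -> u <= s -> g t u <= c) ->
  c * (V 1 - V 0) < s * (1 - lambda * (eta ^+ 2 / 2)) ->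
  lambda * z eta < x 1.
Proof.
move=> g0 iV tr s0 /andP[eta0 eta1] l0 gc sbig.
have [[x0 z0] y0 _ dz _] := tr.
have xs (t : R) : 0 <= t -> t <= 1 -> x t <= s * t.
  exact: trajectory_le g0 iV tr.
have ze : z eta <= s * (eta ^+ 2 / 2).
  have := dderiv_id_le dz (dderiv_half_square s) (lexx 0) (ltW eta0) eta1.
  rewrite z0 /= subr0 expr0n/= mul0r mulr0 subr0; apply => t.
  rewrite in_itv/= => /andP[t0 te]; apply: xs; lra.
have y1 : s - c * (V 1 - V 0) <= y 1.
  suff : y 0 - y 1 <= c * (V 1 - V 0) by lra.
  apply: (trajectory_slope_drop_le iV tr (lexx 0) ler01 (lexx 1)) => t t01.
  move: (t01); rewrite in_itv/= => /andP[t0 t1].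
  apply: gc; first exact: subset_itvW t01.
  apply: le_trans (xs t (ltW t0) (ltW t1)) _.
  by rewrite ler_piMr// ltW.
have /andP[x1 _] := trajectory_chord g0 iV tr (lexx 0) ler01 (lexx 1).
rewrite x0 !subr0 mulr1 in x1.
have := ler_wpM2l l0 ze; lra.
Qed.

(** The trajectory stays below the line of slope [s], hence inside the region
    where [g] dominates [M u]. *)
Lemma defect_lt0_small (R : realType) (g : R -> R -> R) (V p : R -> R)
    (s M eta lambda : R) (x y z : R -> R) :
  (forall t u : R, 0 <= g t u) ->
  integrator V p -> trajectory g V s x y z ->
  0 < s -> 0 < eta <= 1 -> 0 <= lambda -> lambda * (eta ^+ 2 / 2) < 1 ->
  0 <= M -> 80 < M * (V (3 / 4) - V (1 / 4)) ->
  (forall t u : R, t \in `[0, 1] -> 0 < u <= s -> M * u <= g t u) ->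
  x 1 < lambda * z eta.
Proof.
move=> g0 iV tr s0 eta01 l0 l1 M0 Mbig Mg; rewrite ltNge; apply/negP => bc.
have xge := trajectory_ge0 g0 iV tr eta01 l0 l1 bc.
apply: (trajectory_not_superlinear g0 iV tr s0 xge M0 Mbig) => t tm.
have t01 : t \in `[0, 1] by move: tm; rewrite !in_itv/=; lra.
apply: Mg => //; rewrite (trajectory_mid_gt0 g0 iV tr s0 xge tm)/=.
move: t01; rewrite in_itv/= => /andP[t0 t1].
by apply: le_trans (trajectory_le g0 iV tr t0 t1) _; rewrite ler_piMr// ltW.
Qed.

(** A nonnegative trajectory with [x(1/4) <= 4 K] would stay below [16 K],
    where [g] is bounded, and then a large initial slope would carry it above
    [4 K] at [1/4].  So on the middle half it exceeds [K]. *)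
Lemma defect_lt0_large (R : realType) (g : R -> R -> R) (V p : R -> R)
    (s M K C eta lambda : R) (x y z : R -> R) :
  (forall t u : R, 0 <= g t u) ->
  integrator V p -> trajectory g V s x y z ->
  0 < s -> 0 < eta <= 1 -> 0 <= lambda -> lambda * (eta ^+ 2 / 2) < 1 ->
  0 <= M -> 80 < M * (V (3 / 4) - V (1 / 4)) ->
  (forall t u : R, t \in `[0, 1] -> K < u -> M * u <= g t u) ->
  (forall t u : R, t \in `[0, 1] -> u <= 16 * K -> g t u <= C) ->
  C * (V 1 - V 0) + 16 * K < s ->
  x 1 < lambda * z eta.
Proof.
move=> g0 iV tr s0 eta01 l0 l1 M0 Mbig Mg gC sbig.
rewrite ltNge; apply/negP => bc.
have xge := trajectory_ge0 g0 iV tr eta01 l0 l1 bc.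
have q1 : 1 / 4 \in `[1 / 4, 3 / 4 : R] by rewrite in_itv/=; lra.
have q01 : 1 / 4 \in `[0, 1 : R] by rewrite in_itv/=; lra.
have h0 : (0 : R) <= 1 / 4 by lra.
have h1 : (1 / 4 : R) <= 1 by lra.
have [xK|Kx] := leP (x (1 / 4)) (4 * K).
  have [[x0 _] y0 _ _ _] := tr.
  have y1 : s - C * (V 1 - V 0) <= y 1.
    suff : y 0 - y 1 <= C * (V 1 - V 0) by lra.
    apply: (trajectory_slope_drop_le iV tr (lexx 0) ler01 (lexx 1)) => t t01.
    have t01' : t \in `[0, 1] by exact: subset_itvW t01.
    apply: gC => //.
    have := trajectory_harnack g0 iV tr xge t01' q1; lra.
  have y14 := trajectory_slope_le g0 iV tr h0 h1 (lexx 1).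
  have /andP[yl _] := trajectory_chord g0 iV tr (lexx 0) h0 h1.
  rewrite x0 in yl; lra.
apply: (trajectory_not_superlinear g0 iV tr s0 xge M0 Mbig) => t tm.
have t01 : t \in `[0, 1] by move: tm; rewrite !in_itv/=; lra.
apply: Mg => //.
have := trajectory_harnack g0 iV tr xge q01 tm; lra.
Qed.
(** * Shooting *)

Definition euler_defect {R : realType} (g : R -> R -> R) (V : R -> R)
    (eta lambda : R) (n : nat) (s : R) : R :=
  euler_x g V n s n.+1 - lambda * euler_z g V n s (grid_index n eta).

Lemma euler_defect_continuous (R : realType) (g : R -> R -> R) (V : R -> R)
    (eta lambda : R) (n : nat) :
  continuous (fun p : R * R => g p.1 p.2) ->
  continuous (euler_defect g V eta lambda n).
Proof.
move=> cg s; have [cx _ _] := euler_continuous V n n.+1 cg.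
have [_ _ cz] := euler_continuous V n (grid_index n eta) cg.
by apply: cvgB; [exact: cx|apply: cvgM; [exact: cvg_cst|exact: cz]].
Qed.

Lemma euler_defect_cvg (R : realType) (U : set_system nat)
    (FU : UltraFilter U) (Uoo : \oo `<=` U) (g : R -> R -> R) (V : R -> R)
    (S C eta lambda : R) (s : nat -> R) :
  continuous (fun p : R * R => g p.1 p.2) -> (forall t u : R, 0 <= g t u) ->
  (forall t u : R, t \in `[0, 1] -> u <= S -> g t u <= C) ->
  nondecreasing01 V -> {within `[0, 1], continuous V} ->
  0 < eta <= 1 -> 0 <= S -> (forall n, 0 <= s n <= S) ->
  exists x y z : R -> R,
    [/\ trajectory g V (y 0) x y z, s n @[n --> U] --> y 0 &
        euler_defect g V eta lambda n (s n) @[n --> U] -->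
          x 1 - lambda * z eta].
Proof.
move=> cg g0 gC mV cV /andP[eta0 eta1] S0 sS.
have gC' t u : t \in `[0, 1] -> u <= S -> 0 <= g t u <= C.
  by move=> t01 uS; rewrite g0 gC.
have [x [y [z [tr cs gx gz]]]] :=
  euler_cvg_trajectory FU Uoo cg g0 gC' mV cV S0 sS.
have PU : ProperFilter U by exact: ultra_proper.
exists x, y, z; split=> //; apply: cvgB.
  apply: (grid_cvg_at _ gx) => //.
    by rewrite in_itv/= ler01 lexx.
  by apply: cvg_near_cst; apply: filterE => n; rewrite gridn.
apply: cvgM; first exact: cvg_cst.
apply: (grid_cvg_at _ gz) => //.
- by rewrite in_itv/= (ltW eta0).
- by move=> n; exact: grid_index_le.
- apply: cvg_trans (grid_index_cvg (ltW eta0)).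
  by apply: cvg_app; exact: Uoo.
Qed.

(** Trajectories need not be unique, so their defect is not a function of the
    slope.  The intermediate value theorem is applied to the approximations
    instead, whose defects at the two given slopes eventually have the signs
    of their limits; the limit of the resulting slopes is then used. *)
Lemma shooting (R : realType) (g : R -> R -> R) (V : R -> R)
    (eta lambda sm sp : R) :
  continuous (fun p : R * R => g p.1 p.2) -> (forall t u : R, 0 <= g t u) ->
  (forall S : R, exists C : R,
    forall t u : R, t \in `[0, 1] -> u <= S -> g t u <= C) ->
  nondecreasing01 V -> {within `[0, 1], continuous V} ->
  0 < eta <= 1 -> 0 < sm -> 0 < sp ->
  (forall x y z, trajectory g V sm x y z -> x 1 < lambda * z eta) ->
  (forall x y z, trajectory g V sp x y z -> lambda * z eta < x 1) ->
  exists s x y z, [/\ 0 < s, trajectory g V s x y z & x 1 = lambda * z eta].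
Proof.
move=> cg g0 gb mV cV eta01 sm0 sp0 Hm Hp.
have [U [FU Uoo]] := ultraFilterLemma (@eventually_filter).
have PU : ProperFilter U by exact: ultra_proper.
pose a := Num.min sm sp; pose S := Num.max sm sp.
have a0 : 0 < a by rewrite lt_min sm0.
have aS : a <= S by rewrite ge_min le_max lexx.
have S0 : 0 <= S by exact: le_trans (ltW a0) aS.
have [C gC] := gb S.
pose D := euler_defect g V eta lambda.
have cvgD' (s : nat -> R) := @euler_defect_cvg R U FU Uoo g V S C eta lambda s
  cg g0 gC mV cV eta01 S0.
have lim_slope (s l : R) : (fun=> s) n @[n --> U] --> l -> l = s.
  by move=> cl; rewrite -(cvg_lim (@Rhausdorff R) cl) lim_cst.
have Dm : \forall n \near U, D n sm < 0.
  have [|x [y [z [tr cs cD]]]] := cvgD' (fun=> sm).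
    by move=> _; rewrite (ltW sm0) le_max lexx.
  rewrite (lim_slope _ _ cs) in tr; have := Hm _ _ _ tr.
  by rewrite -subr_lt0 => /(cvgr_lt _ cD); exact.
have Dp : \forall n \near U, 0 < D n sp.
  have [|x [y [z [tr cs cD]]]] := cvgD' (fun=> sp).
    by move=> _; rewrite (ltW sp0) le_max lexx orbT.
  rewrite (lim_slope _ _ cs) in tr; have := Hp _ _ _ tr.
  by rewrite -subr_gt0 => /(cvgr_gt _ cD); exact.
have root n : exists s, a <= s <= S /\ (D n sm < 0 -> 0 < D n sp -> D n s = 0).
  have [neg|/negP nneg] := boolP ((D n sm < 0) && (0 < D n sp)); last first.
    exists a; split; first by rewrite lexx.
    by move=> m p; case: nneg; rewrite m.
  move: neg => /andP[m p].
  have [|||s] := @IVT R (D n) a S 0.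
  - exact: aS.
  - by apply: continuous_subspaceT => x; exact: euler_defect_continuous.
  - rewrite /a /S; case: (leP sm sp) => _.
      by rewrite ge_min le_max (ltW m) (ltW p) orbT.
    by rewrite ge_min le_max (ltW m) (ltW p) orbT.
  - by rewrite in_itv/= => saS Ds; exists s.
have [s Hs] := choice root.
have sS n : 0 <= s n <= S.
  by have [/andP[as_ ->] _] := Hs n; rewrite (le_trans (ltW a0) as_).
have [x [y [z [tr cs cD]]]] := cvgD' s sS.
exists (y 0), x, y, z; split=> //.
  apply: lt_le_trans a0 _; apply: cvgr_to_ge cs _.
  by apply: filterE => n; have [/andP[]] := Hs n.
apply/eqP; rewrite -subr_eq0; apply/eqP.
apply: lim_slope; apply: cvg_trans cD; apply: near_eq_cvg.
by apply: filterS2 Dm Dp => n m p; exact: (Hs n).2 m p.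
Qed.
(** * Trajectories solve the conformable equation *)

(** Increments to the left are admissible at every point of the half-open
    interval, so the limits defining the derivatives there are unique. *)
Lemma within_dnbhs0_proper (R : realType) (A : set R) (d : R) :
  0 < d -> (forall h : R, - d < h < 0 -> A h) -> ProperFilter (within A 0^').
Proof.
move=> d0 dA; apply: Build_ProperFilter_ex => B [r /= r0 HB].
pose m := Num.min (d / 2) (r / 2).
have m0 : 0 < m by rewrite lt_min !divr_gt0.
have md : m < d by rewrite gt_min ltr_pdivrMr// ltr_pMr// ltr1n.
have mr : m < r.
  by rewrite gt_min; apply/orP; right; rewrite ltr_pdivrMr// ltr_pMr// ltr1n.
exists (- m); apply: HB.
- by rewrite /ball_/= sub0r opprK ger0_norm// ltW.
- by rewrite oppr_eq0 gt_eqF.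
- by apply: dA; rewrite ltrN2 md oppr_lt0.
Qed.

Lemma incr_to0_proper (R : realType) (t : R) :
  t \in `]0, 1] -> ProperFilter (incr_to0 t).
Proof.
rewrite in_itv/= => /andP[t0 t1].
apply: (within_dnbhs0_proper t0) => h /andP[h1 h2].
by rewrite /= in_itv/=; apply/andP; split; lra.
Qed.

Lemma conf_incr_to0_proper (R : realType) (alpha t : R) :
  t \in `]0, 1] -> ProperFilter (conf_incr_to0 alpha t).
Proof.
rewrite in_itv/= => /andP[t0 t1].
have k0 : 0 < t `^ (2 - alpha) by exact: powR_gt0.
apply: (within_dnbhs0_proper (divr_gt0 t0 k0)) => h /andP[].
rewrite -mulNr ltr_pdivrMr// => h1 h2.
have h3 : h * t `^ (2 - alpha) < 0 by rewrite nmulr_rlt0.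
by rewrite /= in_itv/=; apply/andP; split; lra.
Qed.

Lemma dderiv_diff_quot_cvg (R : realType) (x y : R -> R) (t : R) :
  dderiv id x y -> t \in `]0, 1] ->
  diff_quot x t h @[h --> incr_to0 t] --> y t.
Proof.
move=> dx t01; have PF := incr_to0_proper t01.
have t01' : t \in `[0, 1] by exact: subset_itv_oc_cc t01.
have h0 : h @[h --> incr_to0 t] --> (0 : R).
  by apply: cvg_within_filter; exact: nbhs_dnbhs.
rewrite -[y t]mulr1; apply: (dderiv_quotient_cvg _ dx) => //.
- by apply: (@withinT _ _ [set h | t + h \in `[0, 1]]); exact: dnbhs_filter.
- by rewrite -[X in _ --> X]addr0; apply: cvgD; [exact: cvg_cst|exact: h0].
- apply: cvg_near_cst; apply: (@cvg_within _ 0^' _ _).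
  near=> h => /=; rewrite addrC addKr divff//; near: h.
  exact: nbhs_dnbhs_neq.
Unshelve. all: by end_near.
Qed.

Lemma dderiv_deriv01 (R : realType) (x y : R -> R) (t : R) :
  dderiv id x y -> t \in `]0, 1] -> deriv01 x t = y t.
Proof.
move=> dx t01; have PF := incr_to0_proper t01.
by apply: cvg_lim => //; exact: dderiv_diff_quot_cvg.
Qed.

(** The primitive of the weight [t^(alpha - 2)]: in terms of it the equation
    reads [dx' / dV = - f(t, x)], without a singularity. *)
Definition conf_weight {R : realType} (alpha t : R) : R :=
  t `^ (alpha - 1) / (alpha - 1).

Lemma conf_weight_derive (R : realType) (alpha t : R) :
  1 < alpha -> 0 < t -> is_derive t 1 (conf_weight alpha) (t `^ (alpha - 2)).
Proof.
move=> a1 t0; have a10 : alpha - 1 != 0 by rewrite subr_eq0 gt_eqF.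
have -> : t `^ (alpha - 2) =
    (alpha - 1)^-1 *: ((alpha - 1) * t `^ (alpha - 1 - 1)).
  rewrite /GRing.scale/= mulKf//; congr (_ `^ _); ring.
have -> : conf_weight alpha = (alpha - 1)^-1 \*: ((@powR R)^~ (alpha - 1)).
  by apply/funext => s; rewrite /conf_weight mulrC.
exact: is_deriveZ (is_derive1_powR _ t0).
Qed.

Lemma conf_weight_integrator (R : realType) (alpha : R) :
  1 < alpha -> integrator (conf_weight alpha) (fun t => t `^ (alpha - 2)).
Proof.
move=> a1; have a10 : 0 < alpha - 1 by rewrite subr_gt0.
split.
- move=> a b; rewrite !in_itv/= => /andP[a0 _] /andP[b0 _] ab.
  by rewrite ler_pM2r ?invr_gt0// ge0_ler_powR// ltW.
- apply/subspace_continuousP => t; rewrite /= in_itv/= => /andP[+ _].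
  rewrite le_eqVlt => /predU1P[<-|t0].
    have V0 : conf_weight alpha 0 = 0.
      by rewrite /conf_weight powR0 ?mul0r// gt_eqF.
    rewrite /from_subspace V0; apply/cvgrPdist_le => e e0.
    have /cvgrPdist_le/(_ (e * (alpha - 1)) (mulr_gt0 e0 a10)) := powR_cvg0 a10.
    move=> [d /= d0 Hd]; exists d => //= b bd.
    rewrite in_itv/= => /andP[+ _]; rewrite le_eqVlt => /predU1P[<-|b0].
      by rewrite V0 subrr normr0 ltW.
    have := Hd b bd b0; rewrite !sub0r !normrN => h.
    rewrite /conf_weight normrM (gtr0_norm (x := _^-1)) ?invr_gt0//.
    by rewrite ler_pdivrMr.
  apply: cvg_within_filter.
  apply: differentiable_continuous; apply/derivable1_diffP.
  by case: (conf_weight_derive a1 t0).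
- rewrite /conf_weight ltr_pM2r ?invr_gt0//.
  by apply: gt0_ltr_powR => //; rewrite ?nnegrE ?in_itv/= ?andbT; lra.
- move=> t; rewrite in_itv/= => /andP[t0 _]; split; last exact: powR_ge0.
  exact: conf_weight_derive.
Qed.

(** The increment [e t^(2 - alpha)] of the conformable quotient is the one for
    which [V] increases by [e] to first order. *)
Lemma trajectory_conf_quot_cvg (R : realType) (alpha s : R) (g : R -> R -> R)
    (x y z : R -> R) (t : R) :
  1 < alpha -> trajectory g (conf_weight alpha) s x y z -> t \in `]0, 1] ->
  conf_quot alpha x t e @[e --> conf_incr_to0 alpha t] --> - g t (x t).
Proof.
move=> a1 [_ _ dx _ dy] t01; have PF := conf_incr_to0_proper alpha t01.
have t01' : t \in `[0, 1] by exact: subset_itv_oc_cc t01.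
have t0 : 0 < t by move: t01; rewrite in_itv => /andP[].
pose k := t `^ (2 - alpha).
have k0 : 0 < k by exact: powR_gt0.
have quot : \forall e \near conf_incr_to0 alpha t,
    (y (t + e * k) - y t) / e = conf_quot alpha x t e.
  have H : \forall e \near (0 : R)^', t + e * k \in `]0, 1] ->
      (y (t + e * k) - y t) / e = conf_quot alpha x t e.
    by apply: nearW => e te; rewrite /conf_quot !(dderiv_deriv01 dx).
  exact: H.
apply: cvg_trans (near_eq_cvg quot) _.
have ek : e * k @[e --> (0 : R)^'] --> (0 : R)^'.
  move=> A [d /= d0 Ad]; exists (d / k); first exact: divr_gt0.
  move=> e; rewrite /= sub0r normrN ltr_pdivlMr// => ed e0; apply: Ad.
    by rewrite /= sub0r normrN normrM (gtr0_norm k0).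
  by rewrite mulf_neq0// gt_eqF.
have teK : t + e * k @[e --> (0 : R)^'] --> t.
  rewrite -[X in _ --> X]addr0; apply: cvgD; first exact: cvg_cst.
  by move=> A /nbhs_dnbhs/ek.
rewrite -[- g t (x t)]mulr1; apply: (dderiv_quotient_cvg _ dy) => //.
- have H : \forall e \near (0 : R)^', t + e * k \in `]0, 1] ->
      t + e * k \in `[0, 1].
    by apply: nearW => e; exact: subset_itv_oc_cc.
  exact: H.
- exact: cvg_within_filter.
- apply: cvg_within_filter.
  have pk : t `^ (alpha - 2) * k = 1.
    rewrite /k -powRD ?(gt_eqF t0) ?implybT//.
    have -> : alpha - 2 + (2 - alpha) = 0 by ring.
    by rewrite powRr0.
  have cV := is_derive_quotient_cvg (conf_weight_derive a1 t0).
  have cVk := cvg_comp _ _ ek cV.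
  rewrite -pk.
  have -> : (fun e => (conf_weight alpha (t + e * k) - conf_weight alpha t) / e)
    = fun e =>
      (conf_weight alpha (e * k + t) - conf_weight alpha t) / (e * k) * k.
    by apply/funext => e; rewrite (addrC t) invfM mulrA mulfVK// gt_eqF.
  by apply: cvgM cVk _; exact: cvg_cst.
Qed.

Lemma trajectory_conf_deriv_pos (R : realType) (alpha s : R) (g : R -> R -> R)
    (x y z : R -> R) (t : R) :
  1 < alpha -> trajectory g (conf_weight alpha) s x y z -> t \in `]0, 1] ->
  conf_derivable_pos alpha x t /\ conf_deriv_pos alpha x t = - g t (x t).
Proof.
move=> a1 tr t01; have PF := conf_incr_to0_proper alpha t01.
have cq := trajectory_conf_quot_cvg a1 tr t01.
split; first by apply/cvg_ex; exists (- g t (x t)).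
exact: cvg_lim cq.
Qed.

Lemma trajectory_conf_deriv (R : realType) (alpha s : R) (g : R -> R -> R)
    (x y z : R -> R) (t : R) :
  1 < alpha -> continuous (fun p : R * R => g p.1 p.2) ->
  trajectory g (conf_weight alpha) s x y z -> t \in `[0, 1] ->
  conf_derivable alpha x t /\ conf_deriv alpha x t = - g t (x t).
Proof.
move=> a1 cg tr t01; rewrite /conf_derivable /conf_deriv.
have [->|tneq0] := eqVneq t 0; last first.
  apply: trajectory_conf_deriv_pos tr _ => //; move: t01; rewrite !in_itv/=.
  by move=> /andP[t0 ->]; rewrite lt_neqAle eq_sym tneq0 t0.
have near01 : \forall r \near (0 : R)^'+, r \in `]0, 1].
  near=> r; rewrite in_itv/=; apply/andP; split; near: r.
    exact: nbhs_right_gt.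
  exact: nbhs_right_le.
have lim0 : conf_deriv_pos alpha x r @[r --> (0 : R)^'+] --> - g 0 (x 0).
  have cx : x r @[r --> (0 : R)^'+] --> x 0.
    have [_ _ dx _ _] := tr.
    have /(continuous_within_itvP _ ltr01)[] :=
      dderiv_continuous (@within01_continuous_id R) dx.
    by [].
  have cgx : - g r (x r) @[r --> (0 : R)^'+] --> - g 0 (x 0).
    apply: cvgN; apply: (@continuous2_cvg _ R R R _ _ id x g 0 (x 0)).
    - exact: (cg (0, x 0)).
    - by apply: cvg_within_filter; exact: cvg_id.
    - exact: cx.
  apply: cvg_trans cgx; apply: near_eq_cvg; apply: filterS near01 => r r01.
  by rewrite (trajectory_conf_deriv_pos a1 tr r01).2.
split; last exact: cvg_lim lim0.
split; last by apply/cvg_ex; exists (- g 0 (x 0)).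
apply: filterS near01 => r r01.
by have [] := trajectory_conf_deriv_pos a1 tr r01.
Unshelve. all: by end_near.
Qed.

Lemma dderiv_Rintegral (R : realType) (x z : R -> R) (eta : R) :
  {within `[0, 1], continuous x} -> dderiv id z x -> z 0 = 0 ->
  0 < eta <= 1 -> \int[lebesgue_measure]_(t in `[0, eta]) x t = z eta.
Proof.
move=> cx dz z0 /andP[eta0 eta1].
have sub : `[0, eta] `<=` `[0, 1] by apply: subset_itv; rewrite bnd_simp.
have sub' (t : R) : t \in `]0, eta[ -> t \in `]0, 1[.
  by rewrite !in_itv/= => /andP[-> te]; exact: lt_le_trans te eta1.
have dz' (t : R) : t \in `]0, eta[ -> is_derive t 1 z (x t).
  move=> /sub' t01; rewrite -[x t]mulr1.
  exact: dderiv_is_derive t01 (is_derive_id _ _) dz.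
have cz : {within `[0, eta], continuous z}.
  apply: continuous_subspaceW sub _.
  exact: dderiv_continuous (@within01_continuous_id R) dz.
rewrite /Rintegral (continuous_FTC2 eta0 _ (F := z)) ?z0 ?sube0//.
- exact: continuous_subspaceW cx.
- have /(continuous_within_itvP _ eta0)[_ cz0 cze] := cz.
  by split=> // t /dz'[].
- by move=> t /dz'[_ dzt]; rewrite derive1E.
Qed.

(** The extension of [f] agrees with [f] along a nonnegative trajectory, and
    the nonlocal condition is recovered from [z] by the fundamental theorem of
    calculus. *)
Lemma trajectory_bvp_solution (R : realType) (alpha eta lambda s : R)
    (f g : R -> R -> R) (x y z : R -> R) :
  1 < alpha -> 0 < eta <= 1 ->
  continuous (fun p : R * R => g p.1 p.2) -> (forall t u : R, 0 <= g t u) ->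
  (forall t u : R, t \in `[0, 1] -> 0 <= u -> g t u = f t u) ->
  0 < s -> trajectory g (conf_weight alpha) s x y z ->
  (forall t : R, t \in `[0, 1] -> 0 <= x t) -> x 1 = lambda * z eta ->
  bvp_positive_solution alpha eta lambda f x.
Proof.
move=> a1 eta01 cg g0 gf s0 tr xge bc.
have [[x0 z0] _ dx dz _] := tr.
have cx := dderiv_continuous (@within01_continuous_id R) dx.
split=> //; last first.
  have q : 1 / 2 \in `[1 / 4, 3 / 4 : R] by rewrite in_itv/=; lra.
  exists (1 / 2); first by rewrite in_itv/=; lra.
  rewrite gt_eqF//.
  exact: trajectory_mid_gt0 g0 (conf_weight_integrator a1) tr s0 xge q.
split=> //.
- by move=> t t01; apply/cvg_ex; exists (y t); exact: dderiv_diff_quot_cvg.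
- by move=> t t01; have [] := trajectory_conf_deriv a1 cg tr t01.
- move=> t t01; have [_ ->] := trajectory_conf_deriv a1 cg tr t01.
  by rewrite gf ?xge// addNr.
- by split=> //; rewrite (dderiv_Rintegral cx dz z0 eta01).
Qed.
(** * Extension of the nonlinearity and conclusion *)

Definition clamp01 {R : realType} (t : R) : R := Num.max 0 (Num.min t 1).

(** Shooting may produce negative values before the boundary condition is
    known to hold, so [f] is extended by its boundary values. *)
Definition extend {R : realType} (f : R -> R -> R) (t u : R) : R :=
  f (clamp01 t) (Num.max u 0).

Lemma clamp01_in (R : realType) (t : R) : clamp01 t \in `[0, 1].
Proof.
by rewrite in_itv/= /clamp01 le_max lexx/= ge_max ler01/= ge_min lexx orbT.
Qed.

Lemma clamp01_id (R : realType) (t : R) : t \in `[0, 1] -> clamp01 t = t.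
Proof. by rewrite in_itv/= /clamp01 => /andP[t0 t1]; rewrite min_l// max_r. Qed.

Lemma extendE (R : realType) (f : R -> R -> R) (t u : R) :
  t \in `[0, 1] -> 0 <= u -> extend f t u = f t u.
Proof. by move=> t01 u0; rewrite /extend clamp01_id// max_l. Qed.

Lemma extend_ge0 (R : realType) (f : R -> R -> R) (t u : R) :
  (forall t u : R, t \in `[0, 1] -> 0 <= u -> 0 <= f t u) -> 0 <= extend f t u.
Proof. by move=> f0; apply: f0; rewrite ?clamp01_in// le_max lexx orbT. Qed.

Lemma extend_continuous (R : realType) (f : R -> R -> R) :
  {within `[0, 1] `*` `[0, +oo[, continuous (fun p : R * R => f p.1 p.2)} ->
  continuous (fun p : R * R => extend f p.1 p.2).
Proof.
move=> /subspace_continuousP cf p.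
pose r (q : R * R) : R * R := (clamp01 q.1, Num.max q.2 0).
have rA q : (`[0, 1] `*` `[0, +oo[) (r q).
  split => /=; first exact: clamp01_in.
  by rewrite in_itv/= le_max lexx orbT.
have cm : continuous (@clamp01 R).
  apply: (@max_fun_continuous _ R R (cst 0) (id \min cst 1)).
    by move=> t; exact: cvg_cst.
  by apply: min_fun_continuous => t; [exact: cvg_id|exact: cvg_cst].
have cp : continuous (fun u : R => Num.max u 0).
  apply: (@max_fun_continuous _ R R id (cst 0)) => u; first exact: cvg_id.
  exact: cvg_cst.
have c1 : q.1 @[q --> p] --> p.1 by case: p => a b; exact: cvg_fst.
have c2 : q.2 @[q --> p] --> p.2 by case: p c1 => a b _; exact: cvg_snd.
have ct : clamp01 q.1 @[q --> p] --> clamp01 p.1 by exact: cvg_comp c1 (cm _).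
have cu : Num.max q.2 0 @[q --> p] --> Num.max p.2 0.
  exact: cvg_comp c2 (cp _).
have cr : r q @[q --> p] --> r p by exact (cvg_pair ct cu).
have crA : r q @[q --> p] --> within (`[0, 1] `*` `[0, +oo[) (nbhs (r p)).
  move=> B /cr H; have {}H : \forall q \near p,
      (`[0, 1] `*` `[0, +oo[) (r q) -> B (r q) by exact: H.
  suff : \forall q \near p, B (r q) by [].
  by apply: filterS H => q; apply; exact: rA.
exact: cvg_comp crA (cf _ (rA p)).
Qed.

Lemma extend_bounded (R : realType) (f : R -> R -> R) (S : R) :
  continuous (fun p : R * R => extend f p.1 p.2) ->
  exists C : R, forall t u : R, t \in `[0, 1] -> u <= S -> extend f t u <= C.
Proof.
move=> cg; pose K := `[0, 1] `*` `[0, Num.max S 0] : set (R * R).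
have cK : compact K by apply: compact_setX; exact: segment_compact.
have cgK : compact ((fun p : R * R => extend f p.1 p.2) @` K).
  by apply: continuous_compact cK; exact: continuous_subspaceT.
have [C [_ HC]] := compact_bounded cgK.
exists (C + 1) => t u t01 uS.
have -> : extend f t u = extend f t (Num.max u 0).
  by rewrite /extend [Num.max (Num.max _ _) _]max_l// le_max lexx orbT.
apply: le_trans (ler_norm _) _; apply: (HC (C + 1)); first by rewrite ltrDl.
exists (t, Num.max u 0) => //; split=> //=.
by rewrite in_itv/= le_max lexx orbT/= ge_max !le_max uS lexx orbT.
Qed.

Lemma min01_ratio_le (R : realType) (f : R -> R -> R) (t u : R) :
  (forall t u : R, t \in `[0, 1] -> 0 <= u -> 0 <= f t u) ->
  t \in `[0, 1] -> 0 < u -> min01 (fun t => f t u / u) * u <= extend f t u.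
Proof.
move=> f0 t01 u0; rewrite extendE ?(ltW u0)// -ler_pdivlMr//.
apply: ge_inf; last by exists t.
exists 0 => _ [r r01 <-].
by rewrite divr_ge0 ?f0 ?(ltW u0).
Qed.

Lemma le_max01_ratio (R : realType) (f : R -> R -> R) (t u : R) :
  continuous (fun p : R * R => extend f p.1 p.2) ->
  t \in `[0, 1] -> 0 < u -> extend f t u <= max01 (fun t => f t u / u) * u.
Proof.
move=> cg t01 u0; rewrite extendE ?(ltW u0)// -ler_pdivrMr//.
apply: ub_le_sup; last by exists t.
have [C HC] := extend_bounded u cg.
exists (C / u) => _ [r r01 <-].
by rewrite ler_pM2r ?invr_gt0// -(extendE _ r01 (ltW u0)) HC.
Qed.

Theorem corollary3p6 (R : realType) (alpha eta lambda : R) (f : R -> R -> R)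
  (halpha : 1 < alpha <= 2) (heta : 0 < eta <= 1)
  (hlambda : 0 <= lambda < 2 / eta ^+ 2)
  (f_cont : {within `[0, 1] `*` `[0, +oo[, continuous (fun p : R * R => f p.1 p.2)})
  (f_ge0 : forall t u : R, t \in `[0, 1] -> 0 <= u -> 0 <= f t u)
  (f_lim :
    (min01 (fun t => f t u / u) @[u --> 0^'+] --> +oo /\
     max01 (fun t => f t u / u) @[u --> +oo] --> 0)
    \/
    (max01 (fun t => f t u / u) @[u --> 0^'+] --> 0 /\
     min01 (fun t => f t u / u) @[u --> +oo] --> +oo)) :
  exists x : R -> R, bvp_positive_solution alpha eta lambda f x.
Proof.
have [a1 _] := andP halpha; have [eta0 eta1] := andP heta.
have [l0 l1] := andP hlambda.
have cg := extend_continuous f_cont.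
have g0 (t u : R) : 0 <= extend f t u by exact: extend_ge0.
have gb (S : R) := extend_bounded S cg.
pose V : R -> R := conf_weight alpha.
have iV := conf_weight_integrator a1; have [mV cV midV _] := iV.
have theta0 : lambda * (eta ^+ 2 / 2) < 1.
  by move: l1; rewrite ltr_pdivlMr ?exprn_gt0// mulrA ltr_pdivrMr// mul1r.
pose theta := 1 - lambda * (eta ^+ 2 / 2).
have th0 : 0 < theta by rewrite subr_gt0.
have V01 : 0 <= V 1 - V 0.
  by rewrite subr_ge0; apply: mV; rewrite ?in_itv/= ?lexx ?ler01.
have dV : 0 < V (3 / 4) - V (1 / 4) by rewrite subr_gt0.
(* any constant above the 80 of the bending estimate *)
pose M := 81 / (V (3 / 4) - V (1 / 4)).
have M0 : 0 <= M by rewrite divr_ge0// ltW.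
have Mbig : 80 < M * (V (3 / 4) - V (1 / 4)).
  by rewrite /M divfK ?gt_eqF//; lra.
(* a nonlinearity below [e u] costs at most half of the defect of a line *)
pose e := theta / (2 * (V 1 - V 0 + 1)).
have e0 : 0 < e by rewrite divr_gt0// mulr_gt0// ltr_wpDl.
have eV : e * (V 1 - V 0) <= theta / 2.
  rewrite /e invfM mulrA mulrAC ler_pdivrMr ?ltr_wpDl//.
  by rewrite ler_wpM2l ?divr_ge0 ?ltW//; lra.
suff [sm [sp [sm0 sp0 Hm Hp]]] : exists sm sp : R, [/\ 0 < sm, 0 < sp,
    forall x y z, trajectory (extend f) V sm x y z -> x 1 < lambda * z eta &
    forall x y z, trajectory (extend f) V sp x y z -> lambda * z eta < x 1].
  have [s [x [y [z [s0 tr bc]]]]] :=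
    shooting cg g0 gb mV cV heta sm0 sp0 Hm Hp.
  exists x.
  apply: (@trajectory_bvp_solution R alpha eta lambda s f (extend f) x y z)
    => //.
    by move=> t u t01 u0; exact: extendE.
  by apply: (trajectory_ge0 g0 iV tr heta l0 theta0); rewrite bc.
case: f_lim => -[lim0 limoo].
- have /cvgryPge/(_ M)[r /= r0 Hr] := lim0.
  have /cvgrPdist_le/(_ e e0)[K [Kreal HK]] := limoo.
  have [C gC] := gb (Num.max K 0).
  have C0 : 0 <= C.
    apply: le_trans (g0 0 _) (gC 0 _ _ (lexx _)).
    by rewrite in_itv/= lexx ler01.
  (* the other half of the defect pays for the bound [C] at small arguments *)
  pose sp := 2 * (C * (V 1 - V 0)) / theta + 1.
  have q0 : 0 <= 2 * (C * (V 1 - V 0)) / theta.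
    by rewrite divr_ge0 ?(ltW th0)// !mulr_ge0.
  exists (r / 2), sp; split.
  + exact: divr_gt0.
  + by rewrite ltr_wpDl.
  + move=> x y z tr.
    have r20 : 0 < r / 2 by exact: divr_gt0.
    apply: (defect_lt0_small g0 iV tr r20 heta l0 theta0 M0 Mbig).
    move=> t u t01 /andP[u0 ur]; apply: le_trans (min01_ratio_le f_ge0 t01 u0).
    rewrite ler_wpM2r ?(ltW u0)//; apply: Hr => //.
    rewrite /ball_/= sub0r normrN gtr0_norm//; lra.
  + move=> x y z tr.
    have sp0 : 0 <= sp by rewrite addr_ge0.
    apply: (defect_gt0 (c := C + e * sp) g0 iV tr sp0 heta l0).
      move=> t u t01 us; have [uK|] := leP u (Num.max K 0).
        by apply: le_trans (gC _ _ t01 uK) _; rewrite lerDl mulr_ge0// ltW.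
      rewrite gt_max => /andP[Ku u0].
      apply: le_trans (le_max01_ratio cg t01 u0) _.
      have := HK u Ku; rewrite sub0r normrN ler_norml => /andP[_ h].
      have h1 := ler_wpM2r (ltW u0) h.
      have h2 := ler_wpM2l (ltW e0) us; lra.
    have h1 := ler_wpM2r sp0 eV.
    have h2 : 2 * (C * (V 1 - V 0)) = (sp - 1) * theta.
      by rewrite /sp addrK divfK// gt_eqF.
    have alg (D c d s th : R) : 0 < th -> d * D * s <= th / 2 * s ->
        2 * (c * D) = (s - 1) * th -> (c + d * s) * D < s * th by lra.
    exact: alg th0 h1 h2.
- have /cvgrPdist_le/(_ e e0)[r /= r0 Hr] := lim0.
  have /cvgryPge/(_ M)[K [Kreal HK]] := limoo.
  have [C gC] := gb (16 * Num.max K 0).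
  have K0 : 0 <= Num.max K 0 by rewrite le_max lexx orbT.
  have C0 : 0 <= C.
    apply: le_trans (g0 0 _) (gC 0 _ _ (lexx _)).
    by rewrite in_itv/= lexx ler01.
  pose sm := C * (V 1 - V 0) + 16 * Num.max K 0 + 1.
  have sm1 : C * (V 1 - V 0) + 16 * Num.max K 0 < sm by rewrite ltrDl.
  have sm0 : 0 < sm by apply: le_lt_trans sm1; rewrite addr_ge0// mulr_ge0.
  have r20 : 0 < r / 2 by exact: divr_gt0.
  exists sm, (r / 2); split=> // x y z tr.
  + apply: (defect_lt0_large (K := Num.max K 0) (C := C) g0 iV tr sm0 heta l0
      theta0 M0 Mbig) => // t u t01.
    rewrite gt_max => /andP[Ku u0].
    apply: le_trans (min01_ratio_le f_ge0 t01 u0).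
    by rewrite ler_wpM2r ?(ltW u0)//; exact: HK.
  + have pos (t u : R) : t \in `[0, 1] -> 0 < u -> u <= r / 2 ->
        extend f t u <= e * (r / 2).
      move=> t01 u0 ur; apply: le_trans (le_max01_ratio cg t01 u0) _.
      have ru : `|0 - u| < r by rewrite sub0r normrN gtr0_norm//; lra.
      have := Hr u ru u0; rewrite sub0r normrN ler_norml => /andP[_ h].
      have h1 := ler_wpM2r (ltW u0) h.
      have h2 := ler_wpM2l (ltW e0) ur; lra.
    apply: (defect_gt0 (c := e * (r / 2)) g0 iV tr (ltW r20) heta l0);
      last first.
      have h1 := ler_wpM2r (ltW r20) eV.
      rewrite mulrAC; apply: le_lt_trans h1 _.
      by rewrite mulrC ltr_pM2l// ltr_pdivrMr// ltr_pMr// ltr1n.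
    move=> t u t01 ur; have [u0|u0] := ltP 0 u; first exact: pos.
    (* values at nonpositive arguments are limits of values at small positive
       arguments, the hypothesis at zero being on positive arguments only *)
    have -> : extend f t u = extend f t 0 by rewrite /extend max_r// maxxx.
    have lim_t : extend f t v @[v --> (0 : R)^'+] --> extend f t 0.
      apply: cvg_at_right_filter.
      apply: (@continuous2_cvg _ R R R _ _ (cst t) id (extend f) t 0).
      - exact: (cg (t, 0)).
      - exact: cvg_cst.
      - exact: cvg_id.
    apply: cvgr_to_le lim_t _; near=> v; apply: pos => //; near: v.
    exact: nbhs_right_le.
Unshelve. all: by end_near.
Qed.
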